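(* Let $\chi$ be a $\mathrm{pSO}$ sentence. Then for every $(M,\mathcal{X}) \vDash \mathrm{RCA}_0^*$ and every proper $\Sigma^0_1$-cut $I$ in $(M,\mathcal{X})$, we have $(M,\mathcal{X}) \vDash \chi$ if and only if $(I,\mathrm{Cod}(M/I)) \vDash \chi$.
   Context: $\mathrm{RCA}_0^*$ is the subsystem of second-order arithmetic obtained from $\mathrm{RCA}_0$ by replacing $\Sigma^0_1$-induction with $\Delta^0_0$-induction and adding the axiom $\exp$ asserting totality of exponentiation. A set $D\subseteq\mathbb{N}$ is unbounded if for every $x$ there is $y\in D$ with $y\ge x$; we write $H\subseteq_{\mathrm{cf}} D$ for ''$H$ is an unbounded subset of $D$''. An $\mathcal{L}_2$-sentence $\chi$ is a $\mathrm{pSO}$ sentence if there is a sentence $\gamma$ of second-order logic in a language $(\le,R_1,\dots,R_k)$ ($k\in\omega$, $R_i$ a relation symbol of arity $m_i\in\omega$) such that $\chi$ expresses: ''for all relations $R_1,\dots,R_k$ on $\mathbb{N}$ (i.e. sets coding them) and every unbounded $D\subseteq\mathbb{N}$ there is an unbounded $H\subseteq D$ such that $(H,\le\cap H^2,R_1\cap H^{m_1},\dots,R_k\cap H^{m_k})\vDash\gamma$'', where satisfaction of $\gamma$ is expressed by relativizing first-order quantifiers to $H$ and letting $m$-ary second-order quantifiers range over sets (of the ambient model) that are $m$-ary relations on $H$. For a model $(M,\mathcal{X})$ of $\mathrm{RCA}_0^*$, a cut is a subset $I\subseteq M$ that is downward closed and closed under successor; it is a $\Sigma^0_1$-cut if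 it is definable in $(M,\mathcal{X})$ by a $\Sigma^0_1$ formula (with parameters), and proper if $I\ne M$. For $s\in M$, let $(s)_{\mathrm{Ack}}=\{x\in M: \text{the }x\text{-th binary digit of }s\text{ is }1\}$, and $\mathrm{Cod}(M/I)=\{I\cap (s)_{\mathrm{Ack}}: s\in M\}$; $(I,\mathrm{Cod}(M/I))$ is the $\mathcal{L}_2$-structure with first-order part $I$ (structure inherited from $M$) and second-order part $\mathrm{Cod}(M/I)$. *)

(* Defs.v *)
From mathcomp Require Import all_boot.

Set Implicit Arguments.
Unset Strict Implicit.
Unset Printing Implicit Defensive.

Record L2_structure := L2Structure {
  num :> Type;
  zero : num;
  one : num;
  add : num -> num -> num;
  mul : num -> num -> num;
  lt : num -> num -> Prop;
  sets : (num -> Prop) -> Prop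
}.

Arguments zero {_}.
Arguments one {_}.
Arguments add {_} _ _.
Arguments mul {_} _ _.
Arguments lt {_} _ _.

Definition le {M : L2_structure} (x y : M) : Prop := lt x y \/ x = y.

(* [scons x e] is the environment x, e 0, e 1, ...: variable [ord0] is the
   most recently bound one. *)
Definition scons {T : Type} {n : nat} (x : T) (e : 'I_n -> T) : 'I_n.+1 -> T :=
  fun i => if unlift ord0 i is Some j then e j else x.

Definition enil {T : Type} : 'I_0 -> T :=
  fun i => False_rect T (notF (valP i)).

Inductive term (n : nat) : Type :=
| TVar of 'I_n
| TZero
| TOne
| TAdd of term n & term n
| TMul of term n & term n.

Arguments TZero {n}.
Arguments TOne {n}.

Fixpoint eval (M : L2_structure) n (e : 'I_n -> M) (t : term n) : M :=
  match t with
  | TVar i => e i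
  | TZero => zero
  | TOne => one
  | TAdd t1 t2 => add (eval e t1) (eval e t2)
  | TMul t1 t2 => mul (eval e t1) (eval e t2)
  end.

(* Delta^0_0 formulas with n number variables and k set variables.  The bound
   of a bounded quantifier is a term in the outer variables. *)
Inductive delta0 (k : nat) : nat -> Type :=
| DEq n of term n & term n : delta0 k n
| DLt n of term n & term n : delta0 k n
| DIn n of term n & 'I_k : delta0 k n
| DNot n of delta0 k n : delta0 k n
| DAnd n of delta0 k n & delta0 k n : delta0 k n
| DOr n of delta0 k n & delta0 k n : delta0 k n
| DAll n of term n & delta0 k n.+1 : delta0 k n
| DEx n of term n & delta0 k n.+1 : delta0 k n.

Fixpoint sat0 (M : L2_structure) k (X : 'I_k -> M -> Prop) n (f : delta0 k n) :
    ('I_n -> M) -> Prop :=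
  match f with
  | DEq _ t u => fun e => eval e t = eval e u
  | DLt _ t u => fun e => lt (eval e t) (eval e u)
  | DIn _ t i => fun e => X i (eval e t)
  | DNot _ g => fun e => ~ sat0 X g e
  | DAnd _ g h => fun e => sat0 X g e /\ sat0 X h e
  | DOr _ g h => fun e => sat0 X g e \/ sat0 X h e
  | DAll _ t g => fun e => forall x, lt x (eval e t) -> sat0 X g (scons x e)
  | DEx _ t g => fun e => exists2 x, lt x (eval e t) & sat0 X g (scons x e)
  end.

(* Definability with number parameters e and set parameters X. *)
Definition sigma01 (M : L2_structure) (A : M -> Prop) : Prop :=
  exists n k (f : delta0 k n.+2) (e : 'I_n -> M) (X : 'I_k -> M -> Prop),
    (forall i, sets (X i)) /\
    forall x, A x <-> exists y, sat0 X f (scons y (scons x e)).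

Definition pi01 (M : L2_structure) (A : M -> Prop) : Prop :=
  exists n k (f : delta0 k n.+2) (e : 'I_n -> M) (X : 'I_k -> M -> Prop),
    (forall i, sets (X i)) /\
    forall x, A x <-> forall y, sat0 X f (scons y (scons x e)).

Definition two {M : L2_structure} : M := add one one.

(* Goedel's beta function as a graph: z is the remainder of a modulo
   1 + (i + 1) c. *)
Definition beta (M : L2_structure) (a c i z : M) : Prop :=
  let m := add one (mul (add i one) c) in
  lt z m /\ exists q, a = add (mul q m) z.

(* The graph b ^ x = y, witnessed by a coded sequence b ^ 0, ..., b ^ x. *)
Definition is_pow (M : L2_structure) (b x y : M) : Prop :=
  exists a c : M,
    [/\ beta a c zero one,
        (forall i, lt i x ->
           exists2 z, beta a c i z & beta a c (add i one) (mul z b))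
      & beta a c x y].

Record RCA0_star (M : L2_structure) : Prop := {
  succ_neq0 : forall x : M, add x one <> zero;
  succ_inj : forall x y : M, add x one = add y one -> x = y;
  addn_0 : forall x : M, add x zero = x;
  addn_succ : forall x y : M, add x (add y one) = add (add x y) one;
  muln_0 : forall x : M, mul x zero = zero;
  muln_succ : forall x y : M, mul x (add y one) = add (mul x y) x;
  not_lt0 : forall x : M, ~ lt x zero;
  lt_succ : forall x y : M, lt x (add y one) <-> lt x y \/ x = y;
  delta00_induction :
    forall n k (f : delta0 k n.+1) (e : 'I_n -> M) (X : 'I_k -> M -> Prop),
      (forall i, sets (X i)) ->
      sat0 X f (scons zero e) ->
      (forall x, sat0 X f (scons x e) -> sat0 X f (scons (add x one) e)) ->
      forall x, sat0 X f (scons x e);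
  delta01_comprehension :
    forall A : M -> Prop, sigma01 A -> pi01 A ->
      exists2 X, sets X & forall x, X x <-> A x;
  exp_total : forall b x : M, exists y, is_pow b x y
}.

(* A context is the list of the arities of the relation symbols and of the
   second-order variables in scope; [rvar G m] is the type of those of
   arity m. *)
Inductive rvar : seq nat -> nat -> Type :=
| RZ G m : rvar (m :: G) m
| RS G m m' of rvar G m : rvar (m' :: G) m.

Inductive so_formula : seq nat -> nat -> Type :=
| SEq G n of 'I_n & 'I_n : so_formula G n
| SLe G n of 'I_n & 'I_n : so_formula G n
| SRel G n m of rvar G m & m.-tuple 'I_n : so_formula G n
| SNot G n of so_formula G n : so_formula G n
| SAnd G n of so_formula G n & so_formula G n : so_formula G n
| SOr G n of so_formula G n & so_formula G n : so_formula G n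
| SAll G n of so_formula G n.+1 : so_formula G n
| SEx G n of so_formula G n.+1 : so_formula G n
| SAllR G n m of so_formula (m :: G) n : so_formula G n
| SExR G n m of so_formula (m :: G) n : so_formula G n.

Definition relation (T : Type) (m : nat) : Type := m.-tuple T -> Prop.

Fixpoint renv (T : Type) (G : seq nat) : Type :=
  if G is m :: G' then (relation T m * renv T G')%type else unit.

Fixpoint lookup T G m (v : rvar G m) : renv T G -> relation T m :=
  match v with
  | RZ _ _ => fun r => r.1
  | RS _ _ _ w => fun r => lookup w r.2
  end.

(* What a pSO sentence sees of a structure for second-order arithmetic: its
   order, and for each m the m-ary relations that belong to it. *)
Record rel_structure := RelStructure {
  dom :> Type;
  rle : dom -> dom -> Prop;
  rels : forall m, relation dom m -> Prop
}.

Definition in_rels (N : rel_structure) (D : N -> Prop) : Prop :=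
  rels (fun t : 1.-tuple N => D (thead t)).

Definition unbounded (N : rel_structure) (D : N -> Prop) : Prop :=
  forall x : N, exists2 y, D y & rle x y.

Definition relation_on (N : rel_structure) (H : N -> Prop) m
    (R : relation N m) : Prop :=
  forall t, R t -> forall i, H (tnth t i).

(* First-order quantifiers are relativized to H, so the interpretation R of a
   relation symbol only matters through its restriction to H. *)
Fixpoint so_sat (N : rel_structure) (H : N -> Prop) G n (f : so_formula G n) :
    renv N G -> ('I_n -> N) -> Prop :=
  match f with
  | SEq _ _ x y => fun _ e => e x = e y
  | SLe _ _ x y => fun _ e => rle (e x) (e y)
  | SRel _ _ _ v xs => fun r e => lookup v r (map_tuple e xs)
  | SNot _ _ g => fun r e => ~ so_sat H g r e
  | SAnd _ _ g h => fun r e => so_sat H g r e /\ so_sat H h r e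
  | SOr _ _ g h => fun r e => so_sat H g r e \/ so_sat H h r e
  | SAll _ _ g => fun r e => forall x, H x -> so_sat H g r (scons x e)
  | SEx _ _ g => fun r e => exists2 x, H x & so_sat H g r (scons x e)
  | SAllR _ _ m g => fun r e => forall R : relation N m,
      rels R -> relation_on H R -> so_sat H g (R, r) e
  | SExR _ _ m g => fun r e => exists R : relation N m,
      [/\ rels R, relation_on H R & so_sat H g (R, r) e]
  end.

(* A pSO sentence is given by the arities m_1, ..., m_k of R_1, ..., R_k and
   the second-order sentence gamma in the language (<=, R_1, ..., R_k). *)
Record pSO_sentence := PSO {
  arities : seq nat;
  gamma : so_formula arities 0
}.

Definition pSO_sat (N : rel_structure) (chi : pSO_sentence) : Prop :=
  forall r : renv N (arities chi),
    (forall m (v : rvar (arities chi) m), rels (lookup v r)) ->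
    forall D : N -> Prop, in_rels D -> unbounded D ->
    exists H : N -> Prop,
      [/\ in_rels H, (forall x, H x -> D x), unbounded H
        & so_sat H (gamma chi) r enil].

Definition pairing {M : L2_structure} (x y : M) : M :=
  add (mul (add x y) (add x y)) x.

(* The code of (x) is x itself, so that unary relations are exactly sets. *)
Fixpoint code {M : L2_structure} (s : seq M) : M :=
  match s with
  | [::] => zero
  | x :: s' => if s' is [::] then x else pairing x (code s')
  end.

Definition full_structure (M : L2_structure) : rel_structure :=
  {| dom := M;
     rle := le;
     rels := fun m R => exists2 X, sets X & forall t, R t <-> X (code t) |}.

Definition cut (M : L2_structure) (I : M -> Prop) : Prop :=
  [/\ I zero,
      (forall x y, I y -> lt x y -> I x)
    & forall x, I x -> I (add x one)].

Definition proper (M : L2_structure) (I : M -> Prop) : Prop := ~ forall x, I x.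

(* x belongs to (s)_Ack: s = (2 u + 1) 2 ^ x + r for some u and r < 2 ^ x. *)
Definition Ack (M : L2_structure) (s x : M) : Prop :=
  exists p u r : M,
    [/\ is_pow two x p, lt r p
      & s = add (mul (add (mul two u) one) p) r].

Definition Cod (M : L2_structure) (I : M -> Prop) (X : {x : M | I x} -> Prop) :
    Prop :=
  exists s : M, forall x, X x <-> Ack s (sval x).

(* A cut need not be closed under addition or multiplication, so the code of a
   tuple of elements of I may lie outside I.  An m-ary relation on I therefore
   belongs to (I, Cod(M/I)) when it consists of the tuples of elements of I
   whose code, computed in M, is in (s)_Ack for some s in M.  For m = 1 these
   are the elements of Cod(M/I) ([in_rels_cut] below); and if I is closed under
   the operations, so that (I, Cod(M/I)) is literally an L_2-structure, they
   are the relations coded by elements of Cod(M/I) ([rels_cut] below). *)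
Definition cut_structure (M : L2_structure) (I : M -> Prop) : rel_structure :=
  {| dom := {x : M | I x};
     rle := fun x y => le (sval x) (sval y);
     rels := fun m R => exists s : M, forall t : m.-tuple {x : M | I x},
       R t <-> Ack s (code (map sval t)) |}.

Lemma in_rels_cut (M : L2_structure) (I : M -> Prop)
    (D : cut_structure I -> Prop) :
  in_rels D <-> Cod D.
Proof.
split=> -[s Hs]; exists s.
  by move=> x; exact: (Hs [tuple x]).
by case/tupleP=> x t; rewrite (tuple0 t) theadE /=; exact: Hs.
Qed.

Lemma in_rels_full (M : L2_structure) (D : full_structure M -> Prop) :
  in_rels D <-> exists2 X, sets X & forall x, D x <-> X x.
Proof.
split=> -[X SX HX]; exists X => //.
  by move=> x; exact: (HX [tuple x]).
by case/tupleP=> x t; rewrite (tuple0 t) theadE /=; exact: HX.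
Qed.

Section ClosedCut.

Context (M : L2_structure) (I : M -> Prop).
Context (I0 : I zero) (I1 : I one).
Context (ID : forall x y, I x -> I y -> I (add x y)).
Context (IM : forall x y, I x -> I y -> I (mul x y)).

Definition closed_cut_L2 : L2_structure :=
  {| num := {x : M | I x};
     zero := exist I zero I0;
     one := exist I one I1;
     add := fun x y => exist I _ (ID (svalP x) (svalP y));
     mul := fun x y => exist I _ (IM (svalP x) (svalP y));
     lt := fun x y => lt (sval x) (sval y);
     sets := @Cod M I |}.

Lemma sval_code (s : seq closed_cut_L2) : sval (code s) = code (map sval s).
Proof. by elim: s => [|x [|y s] IH] //=; rewrite /pairing /= IH. Qed.

Lemma rels_cut m (R : relation {x : M | I x} m) :
  @rels (full_structure closed_cut_L2) m R <-> @rels (cut_structure I) m R.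
Proof.
split=> [[X [s Xs] RX]|[s Rs]].
  exists s => t; rewrite -(sval_code t).
  by split=> [/RX /Xs|/Xs /RX].
exists (fun x => Ack s (sval x)); first by exists s.
by move=> t; split=> [/Rs|Rt]; [|apply/Rs]; rewrite -?(sval_code t) // sval_code.
Qed.

End ClosedCut.

(* Main.v *)
(* Let I be a proper Sigma^0_1-cut.  Given D cofinal in I and E unbounded in M,
   enumerating I yields an order isomorphism G, with a graph that is a set,
   between a cofinal subset of D and an unbounded subset of E.  Second-order
   satisfaction is invariant under G once G exchanges the relations of (M, X)
   and those coded in I.  The image of a coded relation is a set by
   comprehension.  Conversely, the preimage of a set is Delta^0_1 on I, and is
   coded: the codes that agree with it below j in I (in the most significant
   bits) form a decreasing sequence of nonempty intervals indexed by I, and if no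
   code were in all of them, Delta^0_1-comprehension would give a proper cut
   which is a set.  The same argument yields Sigma^0_1-bounding, needed to
   enumerate I in its order. *)

From Stdlib Require Import List Ring Classical IndefiniteDescription.
From Stdlib Require Import FunctionalExtensionality PropExtensionality.
From mathcomp Require Import all_boot.
Require Import Defs.

Set Implicit Arguments.
Unset Strict Implicit.
Unset Printing Implicit Defensive.

(* Sigma^0_1-induction fails in a model with a proper Sigma^0_1-cut, so each induction is on a
   Delta^0_0 formula: existential quantifiers carry explicit bounds, and exponentiation enters
   through a set parameter. The stages at which elements of I are listed are unbounded in M, since
   otherwise I would be Delta^0_0 and induction would make it all of M; this is why I, although
   bounded, can index an unbounded subset of M. For the same reason no single bound serves all the
   witnesses needed to decide the preimage of a set, so bounded comprehension cannot code it
   directly. Agreement on leading binary digits, unlike agreement on trailing ones, defines an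
   interval. Another obstacle is that I need not be closed under pairing: the code of a tuple from I
   may lie outside I, so tuples are handled through a bound in I on their components. Because a pSO
   sentence asks only for some unbounded H inside D, and satisfaction looks only inside H, it
   suffices that G be defined on a cofinal part of D. *)
Declare Scope model_scope.
Delimit Scope model_scope with M.
Local Notation "x + y" := (add x y) : model_scope.
Local Notation "x * y" := (mul x y) : model_scope.
Local Notation "x < y" := (lt x y) : model_scope.
Local Notation "x <= y" := (le x y) : model_scope.
Local Notation "0" := zero : model_scope.
Local Notation "1" := one : model_scope.
Local Notation "2" := two : model_scope.
Local Open Scope model_scope.

(** * Delta^0_0-definability *)

Section Definability.

Context (M : L2_structure).

(** Environments are infinite streams, so definability proofs need not count variables; [D0_delta0]
    recovers the finite contexts of [delta0]. *)
Definition push (x : M) (e : nat -> M) : nat -> M :=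
  fun i => if i is j.+1 then e j else x.

Inductive dterm : ((nat -> M) -> M) -> Prop :=
| dterm_var i : dterm (fun e => e i)
| dterm_cst a : dterm (fun=> a)
| dterm_add t u : dterm t -> dterm u -> dterm (fun e => t e + u e)
| dterm_mul t u : dterm t -> dterm u -> dterm (fun e => t e * u e).

(* Delta^0_0-definability with parameters.  The quantified formula of [D0_all]
   is stated for the environment whose head is the bound variable. *)
Inductive D0 : ((nat -> M) -> Prop) -> Prop :=
| D0_eq t u : dterm t -> dterm u -> D0 (fun e => t e = u e)
| D0_lt t u : dterm t -> dterm u -> D0 (fun e => t e < u e)
| D0_set X t : sets X -> dterm t -> D0 (fun e => X (t e))
| D0_not P : D0 P -> D0 (fun e => ~ P e)
| D0_and P Q : D0 P -> D0 Q -> D0 (fun e => P e /\ Q e)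
| D0_all t P : dterm t -> D0 (fun e => P (fun i => e i.+1) (e 0%N)) ->
    D0 (fun e => forall x, x < t e -> P e x).

Definition rec1 (P : M -> Prop) := D0 (fun e => P (e 0%N)).
Definition rec2 (P : M -> M -> Prop) := D0 (fun e => P (e 0%N) (e 1%N)).
Definition rec3 (P : M -> M -> M -> Prop) :=
  D0 (fun e => P (e 0%N) (e 1%N) (e 2%N)).

Lemma D0_ext P Q : D0 P -> (forall e, P e <-> Q e) -> D0 Q.
Proof.
move=> DP PQ; suff <- : P = Q by [].
by apply: functional_extensionality => e; apply: propositional_extensionality.
Qed.

Lemma D0_or P Q : D0 P -> D0 Q -> D0 (fun e => P e \/ Q e).
Proof.
move=> DP DQ; apply: (D0_ext (D0_not (D0_and (D0_not DP) (D0_not DQ)))) => e.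
by split; [move=> h; apply: NNPP; tauto | tauto].
Qed.

Lemma D0_imp P Q : D0 P -> D0 Q -> D0 (fun e => P e -> Q e).
Proof.
move=> DP DQ; apply: (D0_ext (D0_or (D0_not DP) DQ)) => e.
by split; [tauto | move=> h; case: (classic (P e)); tauto].
Qed.

Lemma D0_iff P Q : D0 P -> D0 Q -> D0 (fun e => P e <-> Q e).
Proof. by move=> DP DQ; apply: D0_and; apply: D0_imp. Qed.

Lemma D0_le t u : dterm t -> dterm u -> D0 (fun e => t e <= u e).
Proof. by move=> Dt Du; apply: D0_or; [apply: D0_lt | apply: D0_eq]. Qed.

Lemma D0_ex t P : dterm t -> D0 (fun e => P (fun i => e i.+1) (e 0%N)) ->
  D0 (fun e => exists2 x, x < t e & P e x).
Proof.
move=> Dt DP; have := D0_not DP => /(D0_all (P := fun e x => ~ P e x) Dt).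
move=> /D0_not /D0_ext; apply=> e; split=> [h|[x xt Px] h]; last exact: (h x).
by apply: NNPP => h'; apply: h => x xt Px; apply: h'; exists x.
Qed.

Lemma D0_true : D0 (fun=> True).
Proof. by apply: (D0_ext (D0_eq (dterm_var 0) (dterm_var 0))). Qed.

Lemma dterm_subst t (sg : (nat -> M) -> nat -> M) :
  dterm t -> (forall i, dterm (sg^~ i)) -> dterm (fun e => t (sg e)).
Proof.
move=> Dt Dsg; elim: Dt => [i|a|u v _ IHu _ IHv|u v _ IHu _ IHv].
- exact: Dsg.
- exact: dterm_cst.
- exact: dterm_add.
- exact: dterm_mul.
Qed.

Lemma D0_subst P : D0 P -> forall sg : (nat -> M) -> nat -> M,
  (forall i, dterm (sg^~ i)) -> D0 (fun e => P (sg e)).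
Proof.
elim=> {P} [t u Dt Du|t u Dt Du|X t sX Dt|P _ IH|P Q _ IHP _ IHQ|t P Dt _ IH]
  sg Dsg.
- by apply: D0_eq; apply: dterm_subst.
- by apply: D0_lt; apply: dterm_subst.
- by apply: D0_set => //; apply: dterm_subst.
- exact/D0_not/IH.
- by apply: D0_and; [apply: IHP | apply: IHQ].
apply: (D0_all (P := fun e x => P (sg e) x)); first exact: dterm_subst.
apply: (IH (fun e => push (e 0%N) (sg (fun i => e i.+1)))) => -[|i] /=.
  exact: dterm_var.
by apply: (dterm_subst (Dsg i)) => j; apply: dterm_var.
Qed.

Lemma rec1_app P t : rec1 P -> dterm t -> D0 (fun e => P (t e)).
Proof. by move=> DP Dt; apply: (D0_subst DP (sg := fun e => fun=> t e)). Qed.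

Lemma rec2_app P t u : rec2 P -> dterm t -> dterm u ->
  D0 (fun e => P (t e) (u e)).
Proof.
move=> DP Dt Du.
by apply: (D0_subst DP (sg := fun e => push (t e) (fun=> u e))) => -[|i].
Qed.

Lemma rec3_app P t u v : rec3 P -> dterm t -> dterm u -> dterm v ->
  D0 (fun e => P (t e) (u e) (v e)).
Proof.
move=> DP Dt Du Dv.
by apply: (D0_subst DP (sg := fun e => push (t e) (push (u e) (fun=> v e))))
  => -[|[|i]].
Qed.

(* The variables i < n of a formula with n + m variables are interpreted by e,
   and the others by the parameters. *)
Definition env n m (e p : nat -> M) : 'I_(n + m) -> M :=
  fun i => if (i < n)%N then e i else p (i - n)%N.

Lemma scons_env n m x e p :
  scons x (env e p) = env (push x e) p :> ('I_(n.+1 + m) -> M).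
Proof.
apply: functional_extensionality => i; rewrite /scons /env.
by case: unliftP => [j|] ->.
Qed.

(** The finite data [N] and [ps] are chosen before the context, so that subterms can be compiled in
    one context containing the parameters of all of them. *)
Lemma dterm_term t : dterm t -> exists N ps, forall n m p, (N <= n)%N ->
  (forall a, In a ps -> exists2 j, (j < m)%N & p j = a) ->
  exists u : term (n + m), forall e, eval (env e p) u = t e.
Proof.
elim=> [i|a|u v _ [N [ps IHu]] _ [N' [ps' IHv]]
  |u v _ [N [ps IHu]] _ [N' [ps' IHv]]].
- exists i.+1, [::] => n m p lt_in _.
  exists (TVar (lshift m (Ordinal lt_in))) => e.
  by rewrite /env /= lt_in.
- exists 0%N, [:: a] => n m p _ /(_ a (or_introl erefl)) [j ltjm pj].
  exists (TVar (rshift n (Ordinal ltjm))) => e.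
  by rewrite /env /= ltnNge leq_addr /= addKn.
- exists (maxn N N'), (ps ++ ps') => n m p; rewrite geq_max => /andP[Nn Nn'] hp.
  have [a ha|w wE] := IHu n m p Nn; first by apply/hp/in_app_iff; left.
  have [a ha|w' wE'] := IHv n m p Nn'; first by apply/hp/in_app_iff; right.
  by exists (TAdd w w') => e /=; rewrite wE wE'.
exists (maxn N N'), (ps ++ ps') => n m p; rewrite geq_max => /andP[Nn Nn'] hp.
have [a ha|w wE] := IHu n m p Nn; first by apply/hp/in_app_iff; left.
have [a ha|w' wE'] := IHv n m p Nn'; first by apply/hp/in_app_iff; right.
by exists (TMul w w') => e /=; rewrite wE wE'.
Qed.

(** The same uniformity as in [dterm_term], with set parameters as well; it also allows the context
    to grow by the variable of a bounded quantifier. *)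
Lemma D0_delta0 P : D0 P -> exists N ps Xs, Forall (@sets M) Xs /\
  forall n m p k (X : 'I_k -> M -> Prop), (N <= n)%N ->
  (forall a, In a ps -> exists2 j, (j < m)%N & p j = a) ->
  (forall Y, In Y Xs -> exists i, X i = Y) ->
  exists f : delta0 k (n + m), forall e, sat0 X f (env e p) <-> P e.
Proof.
elim=> {P} [t u /dterm_term[N [ps ht]] /dterm_term[N' [ps' hu]]
  |t u /dterm_term[N [ps ht]] /dterm_term[N' [ps' hu]]
  |Y t sY /dterm_term[N [ps ht]]
  |P _ [N [ps [Xs [sXs IH]]]]
  |P Q _ [N [ps [Xs [sXs IHP]]]] _ [N' [ps' [Xs' [sXs' IHQ]]]]
  |t P /dterm_term[N [ps ht]] _ [N' [ps' [Xs [sXs IH]]]]].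
- exists (maxn N N'), (ps ++ ps'), [::]; split=> // n m p k X.
  rewrite geq_max => /andP[Nn Nn'] hp _.
  have [a ha|w wE] := ht n m p Nn; first by apply/hp/in_app_iff; left.
  have [a ha|w' wE'] := hu n m p Nn'; first by apply/hp/in_app_iff; right.
  by exists (DEq k w w') => e /=; rewrite wE wE'.
- exists (maxn N N'), (ps ++ ps'), [::]; split=> // n m p k X.
  rewrite geq_max => /andP[Nn Nn'] hp _.
  have [a ha|w wE] := ht n m p Nn; first by apply/hp/in_app_iff; left.
  have [a ha|w' wE'] := hu n m p Nn'; first by apply/hp/in_app_iff; right.
  by exists (DLt k w w') => e /=; rewrite wE wE'.
- exists N, ps, [:: Y]; split=> [|n m p k X Nn hp hX]; first by constructor.
  have [w wE] := ht n m p Nn hp; have [i Xi] := hX Y (or_introl erefl).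
  by exists (DIn w i) => e /=; rewrite wE Xi.
- exists N, ps, Xs; split=> // n m p k X Nn hp hX.
  have [f fE] := IH n m p k X Nn hp hX.
  by exists (DNot f) => e /=; split=> h /fE.
- exists (maxn N N'), (ps ++ ps'), (Xs ++ Xs').
  split=> [|n m p k X]; first exact/Forall_app.
  rewrite geq_max => /andP[Nn Nn'] hp hX.
  have [a ha|Y hY|f fE] := IHP n m p k X Nn.
  + by apply/hp/in_app_iff; left.
  + by apply/hX/in_app_iff; left.
  have [a ha|Y hY|g gE] := IHQ n m p k X Nn'.
  + by apply/hp/in_app_iff; right.
  + by apply/hX/in_app_iff; right.
  by exists (DAnd f g) => e /=; split=> -[/fE ? /gE ?].
exists (maxn N N'), (ps ++ ps'), Xs; split=> // n m p k X.
rewrite geq_max => /andP[Nn Nn'] hp hX.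
have [a ha|w wE] := ht n m p Nn; first by apply/hp/in_app_iff; left.
have [|a ha|Y hY|f fE] := IH n.+1 m p k X.
- exact: leqW.
- by apply/hp/in_app_iff; right.
- exact: hX.
exists (DAll w (f : delta0 k (n + m).+1)) => e /=; rewrite wE.
by split=> h x xt; move: (h x xt); rewrite scons_env; [move/fE | move=> ?;
  apply/fE].
Qed.

Lemma eval_dterm n (t : term n) (sg : (nat -> M) -> 'I_n -> M) :
  (forall i, dterm (sg^~ i)) -> dterm (fun e => eval (sg e) t).
Proof.
move=> Dsg; elim: t => [i|||t IHt u IHu|t IHt u IHu] /=.
- exact: Dsg.
- exact: dterm_cst.
- exact: dterm_cst.
- exact: dterm_add.
- exact: dterm_mul.
Qed.

(** The converse translation turns the formula that defines the cut into a predicate to which the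
    closure lemmas apply. An arbitrary [sg] lets the induction pass binders. *)
Lemma sat0_D0 k (X : 'I_k -> M -> Prop) n (f : delta0 k n) :
  (forall i, sets (X i)) -> forall sg : (nat -> M) -> 'I_n -> M,
  (forall i, dterm (sg^~ i)) -> D0 (fun e => sat0 X f (sg e)).
Proof.
move=> sX.
have Dscons n' (sg : (nat -> M) -> 'I_n' -> M) : (forall i, dterm (sg^~ i)) ->
    forall i, dterm (fun e => scons (e 0%N) (sg (fun i => e i.+1)) i).
  move=> Dsg i; rewrite /scons; case: (unlift ord0 i) => [j|].
    by apply: (dterm_subst (Dsg j)) => j'; apply: dterm_var.
  exact: dterm_var.
elim: f => {n} [n t u|n t u|n t i|n f IH|n f IHf g IHg|n f IHf g IHg
  |n t f IH|n t f IH]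
  sg Dsg /=.
- by apply: D0_eq; apply: eval_dterm.
- by apply: D0_lt; apply: eval_dterm.
- by apply: D0_set => //; apply: eval_dterm.
- exact/D0_not/IH.
- by apply: D0_and; [apply: IHf | apply: IHg].
- by apply: D0_or; [apply: IHf | apply: IHg].
- apply: (D0_all (P := fun e x => sat0 X f (scons x (sg e)))).
    exact: eval_dterm.
  exact/IH/Dscons.
- apply: (D0_ex (P := fun e x => sat0 X f (scons x (sg e)))).
    exact: eval_dterm.
  exact/IH/Dscons.
Qed.

Lemma D0_formula P : D0 P -> exists n k (f : delta0 k n.+2) (e : 'I_n -> M)
    (X : 'I_k -> M -> Prop), (forall i, sets (X i)) /\
  forall x y, sat0 X f (scons y (scons x e)) <-> P (push y (push x (fun=> 0))).
Proof.
move=> /D0_delta0[N [ps [Xs [sXs hf]]]].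
have [a|Y|f fE] := hf N.+2 (size ps) (nth 0 ps) (size Xs)
  (fun i => nth (fun=> False) Xs i) (leqW (leqnSn N)).
- move=> /(In_nth _ _ 0)[j [/ltP ltj <-]]; exists j => //.
  by elim: {hf sXs Xs} ps j ltj => [|b ps IH] [|j] //= /IH.
- move=> /(In_nth _ _ (fun=> False))[j [/ltP ltj <-]]; exists (Ordinal ltj) => /=.
  by elim: {hf sXs} Xs j ltj => [|b ps' IH] [|j] //= /IH.
(* The [N] dummy variables after [x] and [y] are set to 0 and count as number parameters. *)
exists (N + size ps)%N, (size Xs), f, (env (fun=> 0) (nth 0 ps)),
  (fun i => nth (fun=> False) Xs i); split=> [i|x y].
  move: (ltn_ord i); move: (nat_of_ord i); elim: sXs => //= Y Ys sY _ IH [|j] //.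
  exact: IH.
by rewrite (@scons_env N) (@scons_env N.+1) -fE.
Qed.

End Definability.

Create HintDb d0.

(** Here [@?t e] abstracts a subexpression over the environment. Atoms are closed by a definability
    hypothesis or by the hint database; some may remain as goals. *)
Ltac d0 := cbv beta; lazymatch goal with
  | |- rec1 _ => unfold rec1; d0
  | |- rec2 _ => unfold rec2; d0
  | |- rec3 _ => unfold rec3; d0
  | |- dterm (fun _ => ?a) => exact: dterm_cst
  | |- dterm (fun e => e _) => exact: dterm_var
  | |- dterm (fun e => @?t e + @?u e) => apply: (dterm_add (t := t) (u := u)); d0
  | |- dterm (fun e => @?t e * @?u e) => apply: (dterm_mul (t := t) (u := u)); d0
  | |- D0 (fun e => @?t e = @?u e) => apply: (D0_eq (t := t) (u := u)); d0
  | |- D0 (fun e => @?t e < @?u e) => apply: (D0_lt (t := t) (u := u)); d0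
  | |- D0 (fun e => @?t e <= @?u e) => apply: (D0_le (t := t) (u := u)); d0
  | |- D0 (fun e => forall x, x < @?t e -> @?P e x) =>
      apply: (D0_all (t := t) (P := P)); d0
  | |- D0 (fun e => exists2 x, x < @?t e & @?P e x) =>
      apply: (D0_ex (t := t) (P := P)); d0
  | |- D0 (fun e => ~ @?P e) => apply: (D0_not (P := P)); d0
  | |- D0 (fun e => @?P e /\ @?Q e) => apply: (D0_and (P := P) (Q := Q)); d0
  | |- D0 (fun e => @?P e \/ @?Q e) => apply: (D0_or (P := P) (Q := Q)); d0
  | |- D0 (fun e => @?P e <-> @?Q e) => apply: (D0_iff (P := P) (Q := Q)); d0
  | |- D0 (fun e => @?P e -> @?Q e) => apply: (D0_imp (P := P) (Q := Q)); d0
  | h : rec1 ?P |- D0 (fun e => ?P (@?t e)) => apply: (rec1_app h); d0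
  | h : rec2 ?P |- D0 (fun e => ?P (@?t e) (@?u e)) => apply: (rec2_app h); d0
  | h : rec3 ?P |- D0 (fun e => ?P (@?t e) (@?u e) (@?v e)) =>
      apply: (rec3_app h); d0
  | h : sets ?X |- D0 (fun e => ?X (@?t e)) => apply: (D0_set h); d0
  | |- D0 (fun e => ?P (@?t e) (@?u e)) =>
      try (apply: (rec2_app (P := P) (t := t) (u := u));
        [solve [auto with d0 nocore] | d0 ..])
  | |- dterm _ => try assumption
  end.

(** * Induction and comprehension for definable predicates *)

Section Model.

Context (M : L2_structure) (HM : RCA0_star M).
Implicit Types (x y z w : M) (P Q : M -> Prop).

Lemma ind P : rec1 P -> P 0 -> (forall x, P x -> P (x + 1)) -> forall x, P x.
Proof.
move=> /D0_formula[n [k [f [e [X [sX fE]]]]]] P0 PS x; apply/(fE 0 x).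
have fP y : sat0 X f (scons y (scons 0 e)) <-> P y by rewrite fE.
suff : sat0 X f (scons x (scons 0 e)) by move/fP=> Px; apply/fE.
apply: (delta00_induction HM (f := f)) => // [|y]; first exact/fP.
by move/fP/PS/fP.
Qed.

(** Negating the Sigma^0_1 definition of the complement by [Q'] gives the Pi^0_1 definition that
    comprehension asks for. *)
Lemma sets_delta1 P (Q Q' : M -> M -> Prop) : rec2 Q -> rec2 Q' ->
  (forall x, P x <-> exists y, Q x y) -> (forall x, ~ P x <-> exists y, Q' x y) ->
  sets P.
Proof.
move=> DQ DQ' PQ PQ'.
have [||X sX XP] := delta01_comprehension HM (A := P); last 1 first.
- suff <- : X = P by [].
  apply: functional_extensionality => x; exact: propositional_extensionality.
- have /D0_formula[n [k [f [e [X [sX fE]]]]]] :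
    D0 (fun e : nat -> M => Q (e 1%N) (e 0%N)).
    by d0.
  exists n, k, f, e, X; split=> // x; rewrite PQ.
  by split=> -[y h]; exists y; apply/fE.
have /D0_formula[n [k [f [e [X [sX fE]]]]]] :
    D0 (fun e : nat -> M => ~ Q' (e 1%N) (e 0%N)).
  by d0.
exists n, k, f, e, X; split=> // x; split=> [Px y|h].
  by apply/fE => /= Q'x; case: (iffRL (PQ' x)) => //; exists y.
apply: NNPP => /PQ'[y Q'x]; exact: (iffLR (fE x y) (h y)).
Qed.

Lemma rec1_sets P : sets P -> rec1 P.
Proof. by move=> sP; d0. Qed.

Lemma sets_rec1 P : rec1 P -> sets P.
Proof.
move=> DP; apply: (sets_delta1 (Q := fun x _ => P x) (Q' := fun x _ => ~ P x));
  try by d0.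
  by move=> x; split=> [|[]] //; exists 0.
by move=> x; split=> [|[]] //; exists 0.
Qed.

(** * Arithmetic *)

Lemma add0l x : 0 + x = x.
Proof.
apply: (ind (P := fun x => 0 + x = x)); first by d0.
  by rewrite (addn_0 HM).
by move=> y IH; rewrite (addn_succ HM) IH.
Qed.

Lemma addSl x y : (x + 1) + y = (x + y) + 1.
Proof.
apply: (ind (P := fun y => (x + 1) + y = (x + y) + 1)); first by d0.
  by rewrite !(addn_0 HM).
by move=> z IH; rewrite !(addn_succ HM) IH.
Qed.

Lemma addC x y : x + y = y + x.
Proof.
apply: (ind (P := fun y => x + y = y + x)); first by d0.
  by rewrite (addn_0 HM) add0l.
by move=> z IH; rewrite (addn_succ HM) addSl IH.
Qed.

Lemma addA x y z : x + (y + z) = x + y + z.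
Proof.
apply: (ind (P := fun z => x + (y + z) = x + y + z)); first by d0.
  by rewrite !(addn_0 HM).
by move=> w IH; rewrite !(addn_succ HM) IH.
Qed.

Lemma mul0l x : 0 * x = 0.
Proof.
apply: (ind (P := fun x => 0 * x = 0)); first by d0.
  by rewrite (muln_0 HM).
by move=> y IH; rewrite (muln_succ HM) IH (addn_0 HM).
Qed.

Lemma mulSl x y : (x + 1) * y = x * y + y.
Proof.
apply: (ind (P := fun y => (x + 1) * y = x * y + y)); first by d0.
  by rewrite !(muln_0 HM) (addn_0 HM).
move=> z IH; rewrite !(muln_succ HM) IH !addA; congr (_ + _).
by rewrite -!addA (addC z).
Qed.

Lemma mulC x y : x * y = y * x.
Proof.
apply: (ind (P := fun y => x * y = y * x)); first by d0.
  by rewrite (muln_0 HM) mul0l.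
by move=> z IH; rewrite (muln_succ HM) mulSl IH.
Qed.

Lemma mulDl x y z : (x + y) * z = x * z + y * z.
Proof.
apply: (ind (P := fun x => (x + y) * z = x * z + y * z)); first by d0.
  by rewrite mul0l !add0l.
by move=> w IH; rewrite addSl !mulSl IH -!addA (addC z).
Qed.

Lemma mulA x y z : x * (y * z) = x * y * z.
Proof.
apply: (ind (P := fun x => x * (y * z) = x * y * z)); first by d0.
  by rewrite !mul0l.
by move=> w IH; rewrite !mulSl IH mulDl.
Qed.

Lemma mul1l x : 1 * x = x.
Proof. by rewrite -(add0l 1) mulSl mul0l add0l. Qed.

Lemma semiring : semi_ring_theory (0 : M) 1 add mul eq.
Proof.
split; [exact: add0l | exact: addC | exact: addA | exact: mul1l | exact: mul0l
       | exact: mulC | exact: mulA | exact: mulDl].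
Qed.

Add Ring model_ring : semiring.

Lemma zero_or_succ x : x = 0 \/ exists y, x = y + 1.
Proof.
(* Bounding the predecessor makes the induction formula Delta^0_0; later existence proofs by
   induction bound their witnesses for the same reason. *)
suff : x = 0 \/ exists2 y, y < x & x = y + 1.
  by case=> [|[y _]]; [left | right; exists y].
apply: (ind (P := fun x => x = 0 \/ exists2 y, y < x & x = y + 1)); first by d0.
  by left.
by move=> y _; right; exists y => //; apply/(lt_succ HM); right.
Qed.

Lemma lt_SS x y : x < y -> x + 1 < y + 1.
Proof.
move: x; apply: (ind (P := fun y => forall x, x < y -> x + 1 < y + 1));
  first by d0.
  by move=> x /(not_lt0 HM).
move=> z IH x /(lt_succ HM)[/IH|->]; last by apply/(lt_succ HM); right.
by move=> h; apply/(lt_succ HM); left.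
Qed.

Lemma lt0S x : 0 < x + 1.
Proof.
apply: (ind (P := fun x => 0 < x + 1)); first by d0.
  by apply/(lt_succ HM); right; ring.
by move=> y IH; apply/(lt_succ HM); left.
Qed.

Lemma lt_def x y : x < y <-> exists d, y = x + d + 1.
Proof.
split=> [xy|[d ->]].
  suff [d _ ->] : exists2 d, d < y + 1 & y = x + d + 1 by exists d.
  move: x xy.
  apply: (ind (P := fun y => forall x, x < y ->
    exists2 d, d < y + 1 & y = x + d + 1)).
  - by d0.
  - by move=> x /(not_lt0 HM).
  move=> z IH x /(lt_succ HM)[/IH[d dz zE]|->].
    by exists (d + 1); [exact: lt_SS | rewrite {1}zE; ring].
  by exists 0; [exact: lt0S | ring].
apply: (ind (P := fun d => x < x + d + 1)); first by d0.
  by rewrite (addn_0 HM); apply/(lt_succ HM); right.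
by move=> z IH; rewrite addA; apply/(lt_succ HM); left.
Qed.

Lemma le_def x y : x <= y <-> exists d, y = x + d.
Proof.
split=> [[/lt_def[d ->]|->]|[d ->]].
- by exists (d + 1); ring.
- by exists 0; ring.
have [->|[d' ->]] := zero_or_succ d; first by right; ring.
by left; apply/lt_def; exists d'; ring.
Qed.

Lemma addIr z x y : x + z = y + z -> x = y.
Proof.
apply: (ind (P := fun z => x + z = y + z -> x = y)); first by d0.
  by rewrite !(addn_0 HM).
by move=> w IH; rewrite !(addn_succ HM) => /(succ_inj HM).
Qed.

Lemma addIl z x y : z + x = z + y -> x = y.
Proof. by rewrite !(addC z); exact: addIr. Qed.

Lemma addS_neq x d : x <> x + d + 1.
Proof.
move=> h; apply: (succ_neq0 HM (x := d)); apply: (@addIl x).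
by rewrite {2}h; ring.
Qed.

Lemma lt_irr x : ~ x < x.
Proof. by move=> /lt_def[d /addS_neq]. Qed.

Lemma le_refl x : x <= x. Proof. by right. Qed.

Lemma ltW x y : x < y -> x <= y. Proof. by left. Qed.

Lemma le_lt_trans y x z : x <= y -> y < z -> x < z.
Proof.
by move=> /le_def[d ->] /lt_def[d' ->]; apply/lt_def; exists (d + d'); ring.
Qed.

Lemma lt_le_trans y x z : x < y -> y <= z -> x < z.
Proof.
by move=> /lt_def[d ->] /le_def[d' ->]; apply/lt_def; exists (d + d'); ring.
Qed.

Lemma lt_trans y x z : x < y -> y < z -> x < z.
Proof. by move=> xy /ltW; exact: lt_le_trans. Qed.

Lemma le_trans y x z : x <= y -> y <= z -> x <= z.
Proof.
by move=> /le_def[d ->] /le_def[d' ->]; apply/le_def; exists (d + d'); ring.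
Qed.

Lemma le0 x : 0 <= x.
Proof. by apply/le_def; exists x; ring. Qed.

Lemma ltS x y : x < y + 1 <-> x <= y.
Proof. exact: lt_succ HM x y. Qed.

Lemma leS x y : x + 1 <= y <-> x < y.
Proof.
by rewrite le_def lt_def; split=> -[d ->]; exists d; ring.
Qed.

Lemma ltSn x : x < x + 1. Proof. exact/ltS/le_refl. Qed.

Lemma leSn x : x <= x + 1. Proof. exact/ltW/ltSn. Qed.

Lemma lt_total x y : x < y \/ y <= x.
Proof.
apply: (ind (P := fun x => x < y \/ y <= x)); first by d0.
  have [->|[z ->]] := zero_or_succ y; first by right; apply: le_refl.
  by left; apply: lt0S.
move=> z [/leS[|<-]|h]; [by left | by right; apply: le_refl |].
by right; apply: le_trans h (leSn _).
Qed.

Lemma ltNge x y : x < y <-> ~ y <= x.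
Proof.
split=> [xy yx|]; first exact: (lt_irr (lt_le_trans xy yx)).
by case: (lt_total x y).
Qed.

Lemma leNgt x y : x <= y <-> ~ y < x.
Proof. by rewrite ltNge; split=> [|/NNPP] //; tauto. Qed.

Lemma le_total x y : x <= y \/ y <= x.
Proof. by case: (lt_total x y) => [/ltW|]; [left | right]. Qed.

Lemma le_anti x y : x <= y -> y <= x -> x = y.
Proof. by case=> // xy /leNgt. Qed.

Lemma lt_neq x y : x < y -> x <> y.
Proof. by move=> xy exy; move: xy; rewrite exy => /lt_irr. Qed.

Lemma lt_gt_eq x y : [\/ x < y, x = y | y < x].
Proof.
by case: (lt_total x y) => [|[|]]; [exact: Or31 | exact: Or33 | move=> ->;
  exact: Or32].
Qed.

Lemma le_add x y z w : x <= y -> z <= w -> x + z <= y + w.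
Proof.
by move=> /le_def[d ->] /le_def[d' ->]; apply/le_def; exists (d + d'); ring.
Qed.

Lemma le_mul x y z w : x <= y -> z <= w -> x * z <= y * w.
Proof.
move=> /le_def[d ->] /le_def[d' ->]; apply/le_def.
by exists (x * d' + d * z + d * d'); ring.
Qed.

Lemma lt_add2l z x y : z + x < z + y <-> x < y.
Proof.
rewrite !lt_def; split=> -[d h]; exists d; last by rewrite h; ring.
by apply: (@addIl z); rewrite h; ring.
Qed.

Lemma le_add2l z x y : z + x <= z + y <-> x <= y.
Proof. by rewrite !leNgt lt_add2l. Qed.

Lemma le_addr x y : x <= x + y.
Proof. by apply/le_def; exists y. Qed.

Lemma le_addl x y : x <= y + x.
Proof. by rewrite addC; apply: le_addr. Qed.

Lemma least P x : rec1 P -> P x ->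
  exists2 y, P y & y <= x /\ forall z, z < y -> ~ P z.
Proof.
move=> DP Px; apply: NNPP => h.
suff h' : forall n z, z < n -> ~ P z by exact: (h' (x + 1) x (ltSn x)).
apply: (ind (P := fun n => forall z, z < n -> ~ P z)); first by d0.
  by move=> z /(not_lt0 HM).
move=> n IH z /(lt_succ HM)[/IH //|->] Pn; apply: h; exists n => //; split=> //.
by apply/leNgt => /IH.
Qed.

Lemma div x y : 0 < y -> exists q r, x = q * y + r /\ r < y.
Proof.
move=> y0; suff [q _ [r ry ->]] :
    exists2 q, q < x + 1 & exists2 r, r < y & x = q * y + r.
  by exists q, r.
apply: (ind (P := fun x =>
  exists2 q, q < x + 1 & exists2 r, r < y & x = q * y + r)).
- by d0.
- by exists 0; [exact: lt0S | exists 0 => //; ring].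
move=> n [q qn [r /leS[ry|ry] nE]].
  exists q; first exact: lt_trans qn (ltSn _).
  by exists (r + 1) => //; rewrite nE; ring.
exists (q + 1); first exact: lt_SS.
by exists 0; [rewrite -ry; exact: lt0S | rewrite nE -ry; ring].
Qed.

Lemma div_uniq y q r q' r' : r < y -> r' < y -> q * y + r = q' * y + r' ->
  q = q' /\ r = r'.
Proof.
have aux p s p' s' : s < y -> p < p' -> p * y + s = p' * y + s' -> False.
  move=> sy /lt_def[d ->] h; move/ltNge: sy; apply.
  suff -> : s = y + (d * y + s') by exact: le_addr.
  by apply: (@addIl (p * y)); rewrite h; ring.
move=> ry ry' h; case: (lt_gt_eq q q') => [qq|qq|qq].
- by case: (aux _ _ _ _ ry qq h).
- by split=> //; move: h; rewrite qq => /addIl.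
by case: (aux _ _ _ _ ry' qq (esym h)).
Qed.

Lemma pairing_gel x y : x <= pairing x y.
Proof. exact: le_addl. Qed.

Lemma le_sqr x : x <= x * x.
Proof.
have [->|[y ->]] := zero_or_succ x; first by right; ring.
by apply/le_def; exists (y * y + y); ring.
Qed.

Lemma pairing_ger x y : y <= pairing x y.
Proof.
apply: le_trans (le_addr _ _); apply: le_trans (le_sqr _); exact: le_addl.
Qed.

Lemma le_pairing x y x' y' : x <= x' -> y <= y' -> pairing x y <= pairing x' y'.
Proof. by move=> xx' yy'; apply: le_add => //; apply: le_mul; apply: le_add. Qed.

(** Since (x + y)^2 <= [pairing x y] < (x + y + 1)^2, the code determines x + y, and then x. *)
Lemma pairing_inj x y x' y' : pairing x y = pairing x' y' -> x = x' /\ y = y'.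
Proof.
have aux (a b a' b' : M) : a + b < a' + b' -> pairing a b = pairing a' b' ->
  False.
  case/lt_def => d h; rewrite /pairing h => h'.
  apply: (@lt_irr ((a + b) * (a + b) + a)); rewrite {2}h'; apply/lt_def.
  by exists (b + (a + b) + ((a + b) * d + (a + b) * d) + (d * d + d + d) + a');
    ring.
move=> h; case: (lt_gt_eq (x + y) (x' + y')) => [hs|hs|hs].
- by case: (aux _ _ _ _ hs h).
- move: h; rewrite /pairing hs => /addIl xx'; split=> //.
  by move: hs; rewrite xx' => /addIl.
by case: (aux _ _ _ _ hs (esym h)).
Qed.

Lemma dterm_pairing (t u : (nat -> M) -> M) : dterm t -> dterm u ->
  dterm (fun e => pairing (t e) (u e)).
Proof. by move=> Dt Du; rewrite /pairing; d0. Qed.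

(* A Delta^0_1 relation is Delta^0_0 in a set parameter.  This makes the graph of
   exponentiation available in Delta^0_0-induction. *)
Lemma rec2_delta1 (R : M -> M -> Prop) (Q Q' : M -> M -> M -> Prop) :
  rec3 Q -> rec3 Q' -> (forall x y, R x y <-> exists z, Q x y z) ->
  (forall x y, ~ R x y <-> exists z, Q' x y z) -> rec2 R.
Proof.
move=> DQ DQ' RQ RQ'.
pose X z := exists x y, z = pairing x y /\ R x y.
have sX : sets X.
  apply: (sets_delta1
    (Q := fun z v => exists2 x, x < z + 1 & exists2 y, y < z + 1 &
      z = pairing x y /\ Q x y v)
    (Q' := fun z v => forall x, x < z + 1 -> forall y, y < z + 1 ->
      z = pairing x y -> Q' x y v)).
  - by rewrite /pairing; d0.
  - by rewrite /pairing; d0.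
  - move=> z; split=> [[x [y [zE /RQ[v Qv]]]]|[v [x _ [y _ [zE Qv]]]]].
      exists v, x; first by apply/ltS; rewrite zE; apply: pairing_gel.
      by exists y => //; apply/ltS; rewrite zE; apply: pairing_ger.
    by exists x, y; split=> //; apply/RQ; exists v.
  move=> z; split=> [h|[v h] [x [y [zE Rxy]]]].
    case: (classic (exists x y, z = pairing x y)) => [[x [y zE]]|no].
      have /RQ'[v Q'v] : ~ R x y by move=> Rxy; apply: h; exists x, y.
      by exists v => x' _ y' _; rewrite zE => /pairing_inj[<- <-].
    by exists 0 => x _ y _ zE; case: no; exists x, y.
  have : ~ R x y; last by [].
  apply/RQ'; exists v; apply: h => //; apply/ltS; rewrite zE.
    exact: pairing_gel.
  exact: pairing_ger.
apply: (D0_ext (P := fun e => X (pairing (e 0%N) (e 1%N)))).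
  by apply: D0_set => //; apply: dterm_pairing; d0.
by move=> e; split=> [[x [y [/pairing_inj[-> ->]]]]|h] //;
  exists (e 0%N), (e 1%N).
Qed.


(** * Powers of two and coded sets *)

Lemma beta_bounded (a c i z : M) : beta a c i z <->
  z < 1 + (i + 1) * c /\ exists2 q, q < a + 1 & a = q * (1 + (i + 1) * c) + z.
Proof.
split=> -[zm [q]]; last by move=> _ aE; split=> //; exists q.
move=> aE; split=> //; exists q => //; apply/ltS.
by rewrite aE; apply/le_def; exists (q * ((i + 1) * c) + z); ring.
Qed.

Lemma D0_beta (t u v w : (nat -> M) -> M) :
  dterm t -> dterm u -> dterm v -> dterm w ->
  D0 (fun e => beta (t e) (u e) (v e) (w e)).
Proof.
move=> Dt Du Dv Dw.
have Dbeta : D0 (fun e : nat -> M => beta (e 0%N) (e 1%N) (e 2%N) (e 3%N)).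
  apply: (@D0_ext M (fun e => e 3%N < 1 + (e 2%N + 1) * e 1%N /\
    exists2 q, q < e 0%N + 1 & e 0%N = q * (1 + (e 2%N + 1) * e 1%N) + e 3%N)).
    by d0.
  by move=> e; rewrite beta_bounded.
by apply: (D0_subst Dbeta
  (sg := fun e => push (t e) (push (u e) (push (v e) (fun=> w e))))) =>
    -[|[|[|i]]].
Qed.

Lemma beta_le (a c i z : M) : beta a c i z -> z <= a.
Proof. by move=> [_ [q ->]]; exact: le_addl. Qed.

Lemma beta_fun (a c i z z' : M) : beta a c i z -> beta a c i z' -> z = z'.
Proof.
move=> [zm [q ->]] [z'm [q' h]].
by have [] := div_uniq zm z'm h.
Qed.

Definition pow_witness (b a c x y : M) : Prop :=
  [/\ beta a c 0 1,
      forall i, i < x -> exists2 z, z < a + 1 &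
        beta a c i z /\ beta a c (i + 1) (z * b)
    & beta a c x y].

Lemma is_pow_witness (b x y : M) :
  is_pow b x y <-> exists a c, pow_witness b a c x y.
Proof.
split=> -[a [c [h0 hS hx]]]; exists a, c; split=> // i /hS[z].
  by move=> hz hz'; exists z => //; apply/ltS/beta_le; exact: hz.
by move=> _ [hz hz']; exists z.
Qed.

(** Induction along the sequences carries each value from one to the other; [beta] values are at
    most [a], so bounding [z] keeps the formula Delta^0_0. *)
Lemma pow_witness_uniq (b a c a' c' x y y' : M) :
  pow_witness b a c x y -> pow_witness b a' c' x y' -> y = y'.
Proof.
move=> [h0 hS hx] [h0' hS' hx'].
suff h : forall i, i <= x -> forall z, z < a + 1 -> beta a c i z ->
  beta a' c' i z.
  apply: (beta_fun _ hx'); apply: (h) (hx); first exact: le_refl.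
  exact/ltS/(beta_le hx).
apply: (ind (P := fun i => i <= x -> forall z, z < a + 1 -> beta a c i z ->
  beta a' c' i z)).
- d0; first by apply: D0_beta; d0.
  by apply: D0_beta; d0.
- by move=> _ z _ /(beta_fun h0) <-.
move=> i IH /leS ix z _ hz.
have [u ua [hu huS]] := hS i ix; have [v va [hv hvS]] := hS' i ix.
rewrite (beta_fun hz huS) (beta_fun (IH (ltW ix) u ua hu) hv).
exact: hvS.
Qed.

Lemma is_pow_fun (b x y y' : M) : is_pow b x y -> is_pow b x y' -> y = y'.
Proof.
by move=> /is_pow_witness[a [c h]] /is_pow_witness[a' [c']];
  exact: pow_witness_uniq h.
Qed.

(** A function of the metatheory, not a term: formulas mention it through the graph [is_pow 2]. *)
Definition pow x : M :=
  proj1_sig (constructive_indefinite_description _ (exp_total HM 2 x)).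

Lemma is_powE x p : is_pow 2 x p <-> p = pow x.
Proof.
rewrite /pow; case: constructive_indefinite_description => y hy /=.
by split=> [h|-> //]; exact: is_pow_fun h hy.
Qed.

Lemma pow0 : pow 0 = 1.
Proof.
have /is_powE : is_pow 2 0 (pow 0) by apply/is_powE.
by move=> /is_powE [a [c [h0 _]]] /(beta_fun h0).
Qed.

Lemma powS x : pow (x + 1) = pow x * 2.
Proof.
have [a [c [h0 hS hx]]] : is_pow 2 (x + 1) (pow (x + 1)) by apply/is_powE.
have [z hz hzS] := hS x (ltSn x).
rewrite (beta_fun hx hzS); congr (_ * _); apply/is_powE.
exists a, c; split=> // i ix; apply: hS; exact: lt_trans ix (ltSn x).
Qed.

(** Totality and uniqueness make the complement of the graph Sigma^0_1 too: [y] is not the power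
    exactly when some other value is witnessed. *)
Lemma rec2_pow : rec2 (@is_pow M 2).
Proof.
pose Q x y v :=
  exists2 a, a < v + 1 & exists2 c, c < v + 1 & pow_witness 2 a c x y.
have DQ : rec3 Q.
  apply: (@D0_ext M (fun e =>
    exists2 a, a < e 2%N + 1 & exists2 c, c < e 2%N + 1 &
    beta a c 0 1 /\
    ((forall i, i < e 0%N ->
      exists2 z, z < a + 1 & beta a c i z /\ beta a c (i + 1) (z * 2)) /\
    beta a c (e 0%N) (e 1%N)))).
    by d0; apply: D0_beta; d0.
  by move=> e; split=> -[a ha [c hc h]]; exists a => //; exists c => //;
     move: h; [case=> ? []|case].
have QE x y : is_pow 2 x y <-> exists v, Q x y v.
  rewrite is_pow_witness; split=> [[a [c h]]|[v [a _ [c _ h]]]];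
    last by exists a, c.
  by exists (a + c), a; [|exists c => //]; apply/ltS;
    [apply: le_addr | apply: le_addl].
apply: (rec2_delta1 (Q := Q)
  (Q' := fun x y v => exists2 y', y' < v + 1 & y' <> y /\ Q x y' v)) => //.
  by d0.
move=> x y; split=> [h|[v [y' _ [yy' h]]] h'].
  have /QE[v [a av [c cv hv]]] : is_pow 2 x (pow x) by apply/is_powE.
  have hle z : z <= v -> z < v + pow x + 1.
    by move=> zv; apply/ltS; apply: le_trans zv (le_addr _ _).
  exists (v + pow x), (pow x); first by apply/ltS/le_addl.
  split; first by move=> e; apply/h/is_powE.
  by exists a; [apply/hle/ltS | exists c; [apply/hle/ltS|]].
by apply: yy'; apply: is_pow_fun h'; apply/QE; exists v.
Qed.

Hint Resolve rec2_pow : d0.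

(** Makes induction on statements about [pow x] legitimate: such a statement and its negation are
    both existential in a variable [p] tied to [x] by the graph, so comprehension yields a set. *)
Lemma rec1_pow (R : M -> M -> Prop) : rec2 R -> rec1 (fun x => R x (pow x)).
Proof.
move=> DR; apply/rec1_sets.
apply: (sets_delta1 (Q := fun x p => is_pow 2 x p /\ R x p)
  (Q' := fun x p => is_pow 2 x p /\ ~ R x p)) => [||x|x]; try by d0.
  by split=> [h|[p [/is_powE ->]]] //; exists (pow x); rewrite is_powE.
by split=> [h|[p [/is_powE ->]]] //; exists (pow x); rewrite is_powE.
Qed.

Lemma powD x y : pow (x + y) = pow x * pow y.
Proof.
suff /is_powE -> : is_pow 2 (x + y) (pow x * pow y) by [].
move: y; apply: ind.
- by apply: (rec1_pow (R := fun y p => is_pow 2 (x + y) (pow x * p))); d0.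
- by apply/is_powE; rewrite pow0 (addn_0 HM); ring.
by move=> z; rewrite !is_powE addA !powS => <-; rewrite mulA.
Qed.

Lemma pow_gt0 x : 0 < pow x.
Proof.
move: x; apply: ind; first by apply: (rec1_pow (R := fun x p => 0 < p)); d0.
  by rewrite pow0 -(add0l 1); apply: lt0S.
move=> x IH; rewrite powS; apply: lt_le_trans IH _.
by apply/le_def; exists (pow x); rewrite /two; ring.
Qed.

Lemma le_pow x y : x <= y -> pow x <= pow y.
Proof.
move=> /le_def[d ->]; rewrite powD; have [h|[z ->]] := zero_or_succ (pow d).
  by case: (lt_neq (pow_gt0 d)).
by apply/le_def; exists (pow x * z); ring.
Qed.

(** Bit [x] is the parity of the quotient by [pow x], and uniqueness of division identifies [q] with
    that quotient. *)
Lemma Ack_div q r x : r < pow x ->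
  Ack (q * pow x + r) x <-> exists u, q = 2 * u + 1.
Proof.
move=> rx; split=> [|[u ->]].
  by move=> [p [u [r' [/is_powE -> rx' /(div_uniq rx rx')[-> _]]]]]; exists u.
by exists (pow x), u, r; split=> //; apply/is_powE.
Qed.

Lemma div_pow s x : exists q r, s = q * pow x + r /\ r < pow x.
Proof. exact: div (pow_gt0 x). Qed.

Lemma rec2_Ack : rec2 (@Ack M).
Proof.
have : rec2 (fun s x : M => exists2 p, p < s + 1 & exists2 u, u < s + 1 &
    exists2 r, r < s + 1 & is_pow 2 x p /\ (r < p /\ s = (2 * u + 1) * p + r)).
  by rewrite /two; d0.
move/D0_ext; apply=> e;
  split=> [[p _ [u _ [r _ [hp [rp sE]]]]]|[p [u [r [hp rp sE]]]]].
  by exists p, u, r.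
have p0 : 1 <= p.
  by move/is_powE: hp => ->; have /leS := pow_gt0 (e 1%N); rewrite add0l.
exists p; first by apply/ltS; rewrite sE; apply/le_def; exists (2 * u * p + r);
  ring.
exists u.
  apply/ltS; rewrite sE; have /le_def[d ->] := p0.
  by apply/le_def; exists (u + 1 + 2 * u * d + d + r); rewrite /two; ring.
by exists r => //; apply/ltS; rewrite sE; apply: le_addl.
Qed.

Hint Resolve rec2_Ack : d0.

Lemma Ack_shift q r l k : r < pow l -> Ack (q * pow l + r) (l + k) <-> Ack q k.
Proof.
move=> rl; have [q' [r' [-> rk]]] := div_pow q k.
have -> : (q' * pow k + r') * pow l + r = q' * pow (l + k) + (r' * pow l + r).
  by rewrite powD; ring.
rewrite !Ack_div //; apply: lt_le_trans (_ : (r' + 1) * pow l <= _).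
  have -> : (r' + 1) * pow l = r' * pow l + pow l by ring.
  exact/lt_add2l.
by rewrite powD (mulC (pow l)); apply: le_mul; [apply/leS | apply: le_refl].
Qed.

Lemma odd_even_false (u v : M) : 2 * u = 2 * v + 1 -> False.
Proof.
have two_gt : 1 < (2 : M) by apply: ltSn.
have two_gt0 : 0 < (2 : M) by rewrite /two; apply: lt0S.
move=> h; have := @div_uniq 2 u 0 v 1 two_gt0 two_gt.
case; first by rewrite mulC (mulC v) -h; ring.
by move=> _; apply: lt_neq; rewrite -(add0l 1); apply: lt0S.
Qed.

Lemma Ack_le s x : Ack s x -> pow x <= s.
Proof.
move=> h; apply/leNgt => sx; move: h; have -> : s = 0 * pow x + s by ring.
rewrite Ack_div // => -[u]; have -> : (0 : M) = 2 * 0 by ring.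
exact: odd_even_false.
Qed.

Lemma Ack_eq s x : s < pow x -> Ack (pow x + s) x.
Proof.
move=> sx; have -> : pow x + s = 1 * pow x + s by ring.
by apply/Ack_div => //; exists 0; ring.
Qed.

(** With n = x + d + 1, adding 2^n adds the even number 2 * 2^d to the quotient by 2^x. *)
Lemma Ack_add s x n : x < n -> Ack (pow n + s) x <-> Ack s x.
Proof.
move=> /lt_def[d ->]; have [q [r [-> rx]]] := div_pow s x.
have -> : pow (x + d + 1) + (q * pow x + r) = (2 * pow d + q) * pow x + r.
  by rewrite powS powD; ring.
rewrite !Ack_div //; split=> -[u h]; last by exists (pow d + u); rewrite h; ring.
have [v [r' [qE]]] : exists v r', q = v * 2 + r' /\ r' < 2.
  by apply: div; rewrite /two; apply: lt0S.
move=> /ltS[|] h'; last by exists v; rewrite qE h'; ring.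
have r0 : r' = 0.
  by move: h'; rewrite -(add0l 1) => /ltS[/(not_lt0 HM)|].
case: (@odd_even_false (pow d + v) u); rewrite -h qE r0; ring.
Qed.

(** The code is built bit by bit: going from [m] to [m + 1] adds [pow m] when [P m] holds. *)
Lemma bounded_comprehension P n : rec1 P ->
  exists2 s, s < pow n & forall x, Ack s x <-> x < n /\ P x.
Proof.
move=> DP.
(* [p] stands for [pow m], so that [rec1_pow] makes the induction formula admissible; the guard
   confines the induction to codes below [pow n]. *)
pose C m p := p <= pow n -> exists2 s, s < pow n & s < p /\
  forall x, x < n -> (Ack s x <-> x < m /\ P x).
have h : forall m, C m (pow m).
  apply: ind; first by apply: (rec1_pow (R := C)); rewrite /C; d0.
  - move=> _; exists 0; first exact: pow_gt0; split; first exact: pow_gt0.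
    move=> x _; split=> [|[/(not_lt0 HM)]//].
    by move=> /Ack_le/leNgt; case; apply: pow_gt0.
  move=> m IH hm.
  have hm' : pow m + pow m <= pow n.
    by move: hm; rewrite powS => /le_def[d ->]; apply/le_def; exists d;
      rewrite /two; ring.
  have [s sn [sm sE]] := IH (le_trans (le_addr _ _) hm').
  have sm2 : pow m + s < pow (m + 1).
    have -> : pow (m + 1) = pow m + pow m by rewrite powS /two; ring.
    exact/lt_add2l.
  have [Pm|Pm] := classic (P m).
    exists (pow m + s); first exact: lt_le_trans hm.
    split=> // x xn; case: (lt_gt_eq x m) => [xm|->|mx].
    - rewrite Ack_add // sE //; split=> -[_ Px]; split=> //.
      exact: lt_trans xm (ltSn m).
    - by split=> _; [split=> //; apply: ltSn | apply: Ack_eq].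
    - split=> [|[/ltS/leNgt h]//]; move=> /Ack_le/leNgt; case.
      by apply: lt_le_trans sm2 _; apply/le_pow/leS.
  exists s => //; split=> [|x xn].
    by apply: lt_le_trans sm _; apply/le_pow/leSn.
  rewrite sE //; split=> -[xm Px]; split=> //; first exact: lt_trans xm (ltSn m).
  by case/ltS: xm => // xm; case: Pm; rewrite -xm.
have [s sn [_ sE]] := h n (le_refl _); exists s => // x.
case: (lt_total x n) => [xn|nx]; first exact: sE.
split=> [|[/ltNge]//]; move=> /Ack_le/leNgt; case;
  exact: lt_le_trans sn (le_pow nx).
Qed.

Lemma odd_decomp (s : M) : exists h b, s = h * 2 + b /\ (b = 0 \/ b = 1).
Proof.
have [h [b [-> /ltS b2]]] : exists h b, s = h * 2 + b /\ b < 2.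
  by apply: div; rewrite /two; apply: lt0S.
exists h, b; split=> //; case: b2 => [|]; last by right.
by rewrite -(add0l 1) => /ltS[/(not_lt0 HM)|]; left.
Qed.

(** Induction on the length: halving [s] and [t] removes their lowest bits and shifts the others
    down by one. *)
Lemma Ack_ext n s t : s < pow n -> t < pow n ->
  (forall x, x < n -> (Ack s x <-> Ack t x)) -> s = t.
Proof.
pose C m p := p <= pow n -> forall s, s < pow n -> forall t, t < pow n ->
  s < p -> t < p -> (forall x, x < m -> (Ack s x <-> Ack t x)) -> s = t.
suff h : forall m, C m (pow m).
  by move=> sn tn; apply: (h n (le_refl _) s sn t tn).
apply: ind; first by apply: (rec1_pow (R := C)); rewrite /C; d0.
  move=> _ {}s _ {}t _; rewrite pow0 -(add0l 1).
  by move=> /ltS[/(not_lt0 HM)//|->] /ltS[/(not_lt0 HM)//|->].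
move=> m IH hm {}s sn {}t tn sm tm st.
have half (x h b : M) : x = h * 2 + b -> x < pow (m + 1) -> h < pow m.
  move=> xE; rewrite xE powS => hx; apply/ltNge => mh; move/ltNge: hx; apply.
  by apply: le_trans (le_addr _ _); apply: le_mul => //; apply: le_refl.
have pow1 : pow 1 = 2 by rewrite -(add0l 1) powS pow0; ring.
have bit (h b : M) : b = 0 \/ b = 1 ->
  forall k, Ack (h * 2 + b) (k + 1) <-> Ack h k.
  move=> hb k; rewrite -pow1 (addC k); apply: Ack_shift; rewrite pow1.
  case: hb => ->; [rewrite /two; exact: lt0S | exact: ltSn].
have bit0 (h b : M) : b = 0 \/ b = 1 -> Ack (h * 2 + b) 0 <-> b = 1.
  move=> hb; have -> : h * 2 + b = (h * 2 + b) * pow 0 + 0 by rewrite pow0; ring.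
  rewrite Ack_div; last exact: pow_gt0.
  case: hb => ->; split=> //.
  - by move=> [u h']; case: (@odd_even_false h u); rewrite -h'; ring.
  - by move=> h01; case: (lt_neq (lt0S 0)); rewrite add0l.
  by move=> _; exists h; ring.
have [h [b [sE hb]]] := odd_decomp s; have [h' [b' [tE hb']]] := odd_decomp t.
have bb : b = 1 <-> b' = 1 by rewrite -(bit0 h) // -(bit0 h') // -sE -tE;
  apply: st; apply: lt0S.
have -> : s = t; last by [].
have hh : h = h'.
  have hm' := half s h b sE sm; have hm'' := half t h' b' tE tm.
  have mn : pow m <= pow n by apply: le_trans hm; apply: le_pow; apply: leSn.
  apply: IH => //; [exact: lt_le_trans mn | exact: lt_le_trans mn |].
  by move=> x xm; rewrite -(bit h b) // -(bit h' b') // -sE -tE; apply/st/lt_SS.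
rewrite sE tE hh; congr (_ + _).
case: hb bb => ->; case: hb' => -> //.
  by case=> _ /(_ erefl).
by case=> /(_ erefl).
Qed.

(** * Enumerations of cuts *)

(* W i w: w is the stage at which an enumeration of the Sigma^0_1 initial segment
   J has listed 0, ..., i. *)
Record modulus (J : M -> Prop) (W : M -> M -> Prop) : Prop := Modulus {
  modulus_rec : rec2 W;
  modulus_fun : forall i w w', W i w -> W i w' -> w = w';
  modulus_dom : forall i, J i <-> exists w, W i w;
  modulus_mono : forall i j w w', i <= j -> W i w -> W j w' -> w <= w';
  modulus_ge : forall i w, W i w -> i <= w
}.

Lemma common_stage (W : M -> M -> Prop) i j w w' : W i w -> W j w' ->
  exists k v, [/\ W k v, i <= k & j <= k].
Proof.
move=> Wi Wj; case: (le_total i j) => ij.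
  by exists j, w'; split=> //; apply: le_refl.
by exists i, w; split=> //; apply: le_refl.
Qed.

(* If every x < B were excluded by some [Good j], the x lying below all of some
   [Good j] would form a set, because the x lying above all of some [Good j] are
   their complement; this set contains 0 and is closed under successor. *)
Lemma nested_intervals J W (Good : M -> M -> M -> Prop) B :
  cut J -> modulus J W -> rec3 Good ->
  (forall j w, W j w -> exists2 x, x < B & Good j w x) ->
  (forall i j w w' x, i <= j -> W i w -> W j w' -> Good j w' x -> Good i w x) ->
  (forall j w x y z, W j w -> Good j w x -> Good j w z -> x <= y -> y <= z ->
     z < B -> Good j w y) ->
  exists2 x, x < B & forall j w, W j w -> Good j w x.
Proof.
move=> [J0 _ _] modW DGood inh anti conv; have DW := modulus_rec modW.
apply: NNPP => nolim.
pose below j w x := forall y, y < x + 1 -> ~ Good j w y.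
pose above j w x := forall y, y < B -> x <= y -> ~ Good j w y.
(* One variable [v] bounds both [j] and [w], so that [S] and its complement get Sigma^0_1
   definitions. *)
pose stage (R : M -> M -> M -> Prop) x v :=
  exists2 j, j < v + 1 & exists2 w, w < v + 1 & W j w /\ R j w x.
have stageE R x : (exists v, stage R x v) <-> exists j w, W j w /\ R j w x.
  split=> [[v [j _ [w _ h]]]|[j [w h]]]; first by exists j, w.
  exists (j + w), j; first exact/ltS/le_addr.
  by exists w => //; apply/ltS/le_addl.
pose S x := exists j w, W j w /\ below j w x.
have disj x : S x -> (exists j w, W j w /\ above j w x) -> False.
  move=> [j [w [Wj bj]]] [j' [w' [Wj' aj']]].
  have [k [v [Wk jk j'k]]] := common_stage Wj Wj'.
  have [y yB Gy] := inh _ _ Wk; case: (lt_total y (x + 1)) => [yx|/leS/ltW xy].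
    by apply: (bj y yx); apply: anti Gy.
  by apply: (aj' y yB xy); apply: anti Gy.
have [w0 W0] : exists w, W 0 w by apply/(modulus_dom modW).
(* If [x] is on neither side, every [Good j] has an element at most [x] and one at least [x], hence
   contains [x] by convexity, contrary to [nolim]. *)
have cover x : ~ S x -> exists j w, W j w /\ above j w x.
  move=> nS; apply: NNPP => nA; apply: nolim.
  have xB : x < B.
    apply/ltNge => Bx; apply: nA; exists 0, w0; split=> // y yB xy.
    by case/ltNge: yB; apply: le_trans xy.
  exists x => // j w Wj.
  have [y yx Gy] : exists2 y, y < x + 1 & Good j w y.
    apply: NNPP => h; apply: nS; exists j, w; split=> // y yx Gy.
    by apply: h; exists y.
  have [z [zB xz Gz]] : exists z, [/\ z < B, x <= z & Good j w z].
    apply: NNPP => h; apply: nA; exists j, w; split=> // z zB xz Gz.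
    by apply: h; exists z.
  by apply: conv Gy Gz _ xz zB => //; apply/ltS.
have sS : sets S.
  apply: (sets_delta1 (Q := stage below) (Q' := stage above)).
  - by rewrite /stage /below; d0.
  - by rewrite /stage /above; d0.
  - by move=> x; rewrite stageE.
  - by move=> x; rewrite stageE; split=> [/cover|h /disj]//; apply.
have [||j [w [Wj bj]]] := ind (rec1_sets sS) _ _ B.
- apply: NNPP => /cover[j [w [Wj aj]]]; have [y yB Gy] := inh _ _ Wj.
  exact: aj yB (le0 _) Gy.
- move=> x [j [w [Wj bj]]]; apply: NNPP => /cover[j' [w' [Wj' aj']]].
  have [k [v [Wk jk j'k]]] := common_stage Wj Wj'.
  have [y yB Gy] := inh _ _ Wk; case: (lt_total y (x + 1)) => [yx|xy].
    by apply: (bj y yx); apply: anti Gy.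
  by apply: (aj' y yB xy); apply: anti Gy.
have [y yB Gy] := inh _ _ Wj.
by apply: bj Gy; apply: lt_trans yB (ltSn B).
Qed.

(* The bits of the code x at the positions k' N, ..., k' N + N - 1, where
   k + k' = b, record the Phi k: the smaller k, the more significant the bits,
   so that the codes which are correct up to j form an interval. *)
Lemma coding J W (Phi : M -> M -> M -> Prop) b N :
  cut J -> modulus J W -> ~ J b -> rec3 Phi ->
  exists2 T : M -> M -> Prop, rec2 T &
  forall k w, W k w -> forall y, y < N -> (T k y <-> Phi k y w).
Proof.
move=> cutJ modW Jb DPhi; have DW := modulus_rec modW; have [J0 Jdown JS] := cutJ.
have Jlt j w : W j w -> j < b.
  move=> Wj; apply/ltNge => bj; apply: Jb.
  have Jj : J j by apply/(modulus_dom modW); exists w.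
  by case: bj => [/Jdown|->]; [apply|].
have Wdown j w k : W j w -> k < j -> exists2 v, W k v & v <= w.
  move=> Wj kj; have /(modulus_dom modW)[v Wk] : J k.
    by apply: Jdown kj; apply/(modulus_dom modW); exists w.
  by exists v => //; apply: (modulus_mono modW) Wk Wj; apply: ltW.
case: (zero_or_succ N) => [->|[N' NE]].
  by exists (fun _ _ => False) => [|k w _ y /(not_lt0 HM)//];
    apply: (D0_ext (D0_not (D0_true M))); tauto.
have N0 : 0 < N by rewrite NE; apply: lt0S.
pose n := (b + 1) * N.
(* For [k < j] the stage [v] of [k] is at most the stage [w] of [j], so the bound on [v] excludes
   nothing and keeps [Good] Delta^0_0. *)
pose Good j w x := forall k, k < j -> forall k', k' < b + 1 -> k + k' = b ->
  forall y, y < N -> forall v, v < w + 1 -> W k v ->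
  (Ack x (k' * N + y) <-> Phi k y v).
have posn k' y : k' < b + 1 -> y < N -> k' * N + y < n.
  move=> k'b yN; apply: (@lt_le_trans ((k' + 1) * N)).
    have -> : (k' + 1) * N = k' * N + N by ring.
    exact/lt_add2l.
  by apply: le_mul (le_refl _); apply/leS.
have [||||x _ Gx] := nested_intervals (Good := Good) (B := pow n) cutJ modW.
- by rewrite /Good; d0.
- move=> j w Wj.
  have [|x xB xE] := @bounded_comprehension (fun p => exists2 k, k < j &
    exists2 k', k' < b + 1 & exists2 y, y < N & exists2 v, v < w + 1 &
    k + k' = b /\ (p = k' * N + y /\ (W k v /\ Phi k y v))) n; first by d0.
  exists x => // k kj k' k'b kk' y yN v vw Wk; rewrite xE.
  split=> [[_ [k2 _ [k2' _ [y2 y2N [v2 _ [kk2 [/div_uniq h [Wk2 Phik2]]]]]]]]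
    |Phik].
    have [k'E yE] := h yN y2N; rewrite yE.
    have kE : k = k2 by apply: (@addIr k'); rewrite kk' k'E.
    by move: Phik2 Wk2; rewrite -kE => + /(modulus_fun modW Wk) ->.
  split; first exact: posn.
  by exists k => //; exists k' => //; exists y => //; exists v.
- move=> i j w w' x ij Wi Wj Gx k ki k' k'b kk' y yN v vw Wk.
  apply: Gx => //; first exact: lt_le_trans ij.
  by apply: lt_le_trans vw _; apply/leS/ltS/(modulus_mono modW ij).
- move=> j w x y z Wj Gx Gz xy yz zB.
  have /le_def[j' bE] := ltW (Jlt _ _ Wj).
  (* As b = j + j', the blocks of the indices k < j are those with k' >= j' + 1; they occupy the
     positions from [l] on. *)
  pose l := (j' + 1) * N.
  have high k k' : k + k' = b -> (k < j <-> j' + 1 <= k').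
    move=> kk'; split=> [/lt_def[d jE]|/le_def[d k'E]].
      apply/le_def; exists d; apply: (@addIl k); rewrite kk' bE jE; ring.
    apply/lt_def; exists d; apply: (@addIr j'); rewrite -bE -kk' k'E; ring.
  have [q [r [xE rl]]] := div_pow x l; have [q' [r' [zE r'l]]] := div_pow z l.
  have xB : x < pow n by apply: le_lt_trans zB; apply: le_trans yz.
  have quo_lt p s t : t = p * pow l + s -> t < pow n -> p < pow n.
    move=> ->; apply: le_lt_trans; apply: le_trans (le_addr _ _).
    have /leS := pow_gt0 l; rewrite add0l => /le_def[d ->].
    by apply/le_def; exists (p * d); ring.
  (* Both [x] and [z] are correct on the blocks above [l], so they have the same bits from there on;
     any [y] between them then has the same quotient by [pow l]. *)
  have qq' : q = q'.
    apply: (Ack_ext (quo_lt _ _ _ xE xB) (quo_lt _ _ _ zE zB)) => i _.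
    rewrite -(Ack_shift q i rl) -(Ack_shift q' i r'l) -xE -zE.
    have [k' [t [lE tN]]] := div (l + i) N0; rewrite lE.
    have jk' : j' + 1 <= k'.
      apply/leNgt => /leS k'j; have /leNgt := le_addr l i; apply; rewrite lE.
      apply: (@lt_le_trans ((k' + 1) * N)); last by apply: le_mul (le_refl _).
      have -> : (k' + 1) * N = k' * N + N by ring.
      exact/lt_add2l.
    case: (lt_total k' (b + 1)) => [k'b|bk'].
      have /ltS/le_def[k bkE] := k'b.
      have kk' : k + k' = b by rewrite bkE addC.
      have kj := iffRL (high k k' kk') jk'.
      have [v Wk vw] := Wdown _ _ _ Wj kj.
      have vw1 : v < w + 1 by apply/ltS.
      by rewrite (Gx k kj k' k'b kk' t tN v vw1 Wk)
        (Gz k kj k' k'b kk' t tN v vw1 Wk).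
    have nE : pow n <= pow (k' * N + t).
      by apply: le_pow; apply: le_trans (le_addr _ _); apply: le_mul (le_refl _).
    by split=> /Ack_le h; [case/(ltNge x): xB | case/(ltNge z): zB];
      apply: le_trans h.
  move: xy yz => /le_def[d yE] /le_def[d' zE'].
  have rdl : r + d < pow l.
    apply: le_lt_trans r'l; apply/le_def; exists d'; apply: (@addIl (q * pow l)).
    by rewrite {1}qq' -zE zE' yE xE; ring.
  move=> k kj k' k'b kk' t tN v vw Wk.
  rewrite -(Gx k kj k' k'b kk' t tN v vw Wk).
  have /le_def[d2 ->] := iffLR (high k k' kk') kj.
  have -> : (j' + 1 + d2) * N + t = l + (d2 * N + t) by rewrite /l; ring.
  have -> : y = q * pow l + (r + d) by rewrite yE xE; ring.
  by rewrite xE !Ack_shift.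
exists (fun k y => exists2 k', k' < b + 1 & k + k' = b /\ Ack x (k' * N + y)).
  by d0.
move=> k w Wk y yN.
have /le_def[k' bE] := ltW (Jlt _ _ Wk).
have k'b : k' < b + 1 by apply/ltS; rewrite bE; apply: le_addl.
(* [Good j] concerns only indices below [j], so block [k] is read at stage [k + 1]. *)
have [v WSk] : exists v, W (k + 1) v.
  by apply/(modulus_dom modW)/JS/(modulus_dom modW); exists w.
rewrite -(Gx _ _ WSk k (ltSn k) k' k'b (esym bE) y yN w _ Wk); last first.
  by apply/ltS; apply: (modulus_mono modW (leSn k)).
split=> [[k2 _ [kk2]]|h]; last by exists k'.
suff <- : k2 = k' by [].
by apply: (@addIl k); rewrite kk2.
Qed.

Lemma sigma01_rec2 P : sigma01 P ->
  exists2 R : M -> M -> Prop, rec2 R & forall x, P x <-> exists y, R x y.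
Proof.
move=> [n [k [f [p [X [sX fE]]]]]].
exists (fun x y => sat0 X f (scons y (scons x p))) => //.
apply: (sat0_D0 f sX) => i; rewrite /scons.
case: (unlift ord0 i) => [j|]; last exact: dterm_var.
case: (unlift ord0 j) => [j'|]; [exact: dterm_cst | exact: dterm_var].
Qed.

(** If all stages lay below [z], then [J] would be Delta^0_0 with bound [z], and induction would
    make it all of [M]. *)
Lemma modulus_unbounded J W : cut J -> proper J -> modulus J W ->
  forall z, exists i w, W i w /\ z <= w.
Proof.
move=> [J0 _ JS] propJ modW z; have DW := modulus_rec modW; apply: NNPP => h.
have bound i : J i <-> exists2 w, w < z & W i w.
  rewrite (modulus_dom modW); split=> [[w Wi]|[w _ Wi]]; last by exists w.
  by exists w => //; apply/ltNge => zw; apply: h; exists i, w.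
apply: propJ; apply: ind => //.
by apply: (D0_ext (P := fun e => exists2 w, w < z & W (e 0%N) w));
  [d0 | move=> e; rewrite bound].
Qed.

(* W i is the least element of E above i and above witnesses for 0, ..., i.  That
   such a bound exists is Sigma^0_1-bounding.  Suppose that e in I has none, and
   let J be the cut of the i which have one.  The stages w_j, j in J, are
   unbounded, so each i <= e is witnessed below some w_j; by [coding], the least
   such j is given by a function of the model, hence bounded by an element of J
   and e is in J. *)
Lemma cut_modulus I E : cut I -> sigma01 I -> proper I -> rec1 E ->
  (forall x, exists2 y, E y & x <= y) ->
  exists2 W, modulus I W & forall i w, W i w -> E w.
Proof.
move=> [I0 Idown IS] /sigma01_rec2[R DR IR] propI DE unbE.
pose cov i w := i <= w /\
  (E w /\ forall j, j < i + 1 -> exists2 y, y < w + 1 & R j y).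
pose W i w := cov i w /\ forall v, v < w -> ~ cov i v.
pose J i := exists w, W i w.
have Dcov : rec2 cov by rewrite /cov; d0.
have DW : rec2 W by rewrite /W; d0.
have covW i w : cov i w -> exists2 v, W i v & v <= w.
  move=> Cw; have [|v Cv [vw h]] := @least (cov i) w _ Cw; first by d0.
  by exists v.
have cov_down i j w : i <= j -> cov j w -> cov i w.
  move=> ij [jw [Ew h]]; split; first exact: le_trans jw.
  split=> // k ki; apply: h; apply: lt_le_trans ki _.
  by rewrite !(addC _ 1); apply/le_add2l.
have modW : modulus J W.
  split=> //.
  - move=> i w w' [Cw hw] [Cw' hw']; apply: le_anti; apply/leNgt => h.
      exact: hw h Cw'.
    exact: hw' h Cw.
  - move=> i j w w' ij [_ hw] [Cw' _]; apply/leNgt => h.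
    by apply: hw h _; apply: cov_down Cw'.
  - by move=> i w [[]].
have Jcov i w y : (forall j, j < i -> exists2 z, z < w + 1 & R j z) -> R i y ->
  J i.
  move=> h Ry; have [v Ev vE] := unbE (w + y + i).
  have leE z : z <= w + y -> z < v + 1.
    move=> zE; apply/ltS; apply: le_trans zE _; apply: le_trans vE;
      exact: le_addr.
  have [|u Wu _] := covW i v; last by exists u.
  split; first by apply: le_trans vE; apply: le_addl.
  split=> // j /ltS[/h[z /ltS zw Rz]|->].
    by exists z => //; apply: leE; apply: le_trans zw (le_addr _ _).
  by exists y => //; apply: leE; apply: le_addl.
have JI i : J i -> I i.
  move=> [w [[_ [_ h]] _]]; have [y _ Ry] := h i (ltSn i).
  by apply/IR; exists y.
have cutJ : cut J.
  split.
  - by have /IR[y Ry] := I0; apply: (@Jcov 0 0 y) Ry => j /(not_lt0 HM).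
  - move=> i j [w [Cw _]] ij; have [|v Wv _] := covW i w; last by exists v.
    exact: cov_down (ltW ij) Cw.
  move=> i Ji; have /IS/IR[y Ry] := JI _ Ji; case: Ji => w [[_ [_ h]] _].
  exact: (@Jcov (i + 1) w y).
suff JE : J = I by exists W; [rewrite -JE | move=> i w [[_ []]]].
apply: functional_extensionality => e; apply: propositional_extensionality.
split=> [/JI //|Ie]; apply: NNPP => nJe.
have [J0 Jdown JS] := cutJ.
have Je_lt j : J j -> j < e.
  move=> Jj; apply/ltNge => -[/(Jdown _ _ Jj)|ej] //.
  by apply: nJe; rewrite ej.
(* The relation coded says that [y] has a witness by the stage of [k]; [e] lies above [J], and
   blocks of [e + 1] bits cover all [y <= e]. *)
have [|T DT TE] := @coding J W (fun k y w => exists2 z, z < w + 1 & R y z)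
  e (e + 1) cutJ modW nJe; first by d0.
have stage i : i < e + 1 -> exists j, J j /\ T j i.
  move=> ie; have /IR[y Ry] : I i.
    by case/ltS: ie => [/Idown|->]; [apply|].
  have [|j [w [Wj yw]]] := modulus_unbounded cutJ _ modW y; first by move/(_ e).
  exists j; split; first by exists w.
  by apply/(TE _ _ Wj) => //; exists y => //; apply/ltS.
(* A least common bound of the indices at which all [i <= e] are witnessed; [e] itself is such a
   bound because [J] lies below it. *)
have [||k kT [_ kmin]] := @least
    (fun k => forall i, i < e + 1 -> exists2 j, j < k + 1 & T j i) e.
- by d0.
- move=> i /stage[j [Jj Tj]]; exists j => //; apply/ltS/ltW; exact: Je_lt.
(* If [k] were outside [J], every index in [J] would be at most the predecessor of [k], which would
   then be a smaller bound. *)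
have [w Wk] : J k.
  apply: NNPP => nJk; have [k0|[k' kE]] := zero_or_succ k.
    by apply: nJk; rewrite k0.
  apply: (kmin k'); first by rewrite kE; apply: ltSn.
  move=> i /stage[j [Jj Tj]]; exists j => //.
  apply/ltNge => k'j; apply: nJk; rewrite kE.
  by case: k'j => [/(Jdown _ _ Jj)|->].
have /IR[y Ry] := Ie; apply: nJe; apply: (@Jcov e w y) Ry => i ie.
have ie1 : i < e + 1 by apply: lt_trans ie (ltSn e).
have [j /ltS jk Tj] := kT i ie1.
have [v Wj] : J j.
  by case: jk => [/Jdown|->]; [apply; exists w | exists w].
have [z zv Rz] := iffLR (TE _ _ Wj i ie1) Tj.
exists z => //; apply: lt_le_trans zv _.
by rewrite !(addC _ 1); apply/le_add2l; apply: (modulus_mono modW) jk Wj Wk.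
Qed.

(* Keeping only the first element of D at which W takes a given value makes W
   injective. *)
Lemma cofinal_isomorphism I D E : cut I -> sigma01 I -> proper I ->
  rec1 D -> (forall i, I i -> exists j, [/\ I j, D j & i <= j]) ->
  rec1 E -> (forall x, exists2 y, E y & x <= y) ->
  exists W G, [/\ modulus I W, rec2 G,
    forall i x, G i x -> [/\ W i x, D i & E x],
    forall i j x y, G i x -> G j y -> i < j -> x < y
  & forall i x, I i -> exists j y, [/\ G j y, i <= j & x <= y]].
Proof.
move=> cutI sigmaI propI DD unbD DE unbE.
have [W modW WE] := cut_modulus cutI sigmaI propI DE unbE.
have DW := modulus_rec modW.
pose G i x := W i x /\ (D i /\ forall j, j < i -> D j -> ~ W j x).
exists W, G; split=> //.
- by rewrite /G; d0.
- by move=> i x [Wi [Di _]]; split=> //; apply: WE Wi.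
- move=> i j x y [Wi [Di _]] [Wj [_ h]] ij.
  by case: (modulus_mono modW (ltW ij) Wi Wj) => // xy; case: (h i ij Di);
    rewrite -xy.
move=> i x Ii; have [j [w [Wj xw]]] := modulus_unbounded cutI propI modW x.
have [_ Idown _] := cutI.
have [k [v [Wk ik jk]]] : exists k v, [/\ W k v, i <= k & j <= k].
  by have /(modulus_dom modW)[u Wi] := Ii; apply: common_stage Wi Wj.
have [d [Id Dd kd]] : exists d, [/\ I d, D d & k <= d].
  by apply: unbD; apply/(modulus_dom modW); exists v.
have /(modulus_dom modW)[a Wd] := Id.
have xa : x <= a by apply: le_trans xw _;
  apply: modulus_mono modW _ _ _ _ _ Wj Wd; apply: le_trans kd.
have [j' [w' [Wj' aw']]] := modulus_unbounded cutI propI modW (a + 1).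
have [d' [Id' Dd' jd']] : exists d, [/\ I d, D d & j' <= d].
  by apply: unbD; apply/(modulus_dom modW); exists w'.
have /(modulus_dom modW)[a' Wd'] := Id'.
have aa' : a < a'.
  by apply/leS; apply: le_trans aw' _; apply: (modulus_mono modW) Wj' Wd'.
(* The least [l] in [D] whose value exceeds [a] without exceeding [a'] is the first to take its
   value; it lies above [d] by monotonicity. *)
have [||l [Dl [y ya' [Wl ay]]] [_ lmin]] := @least
    (fun l => D l /\ exists2 y, y < a' + 1 & W l y /\ a < y) d'.
- by d0.
- by split=> //; exists a'; [apply: ltSn|].
exists l, y; split.
- split=> //; split=> // l' ll' Dl' Wl'.
  by apply: (lmin l' ll'); split=> //; exists y.
- apply: ltW; apply: (@le_lt_trans d); first exact: le_trans ik kd.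
  apply/ltNge => ld; move/ltNge: ay; apply.
  exact: (modulus_mono modW) ld Wl Wd.
exact/ltW/(le_lt_trans xa).
Qed.

(** * Relations on a cut *)

Section RelationCodes.

Context (Q : M -> M -> Prop).

(** The parts of a pair are at most its code, so every quantifier can be bounded. Length 1 is
    separate because [code] sends a one-element list to its element. *)
Fixpoint rel_code m : M -> M -> Prop :=
  match m with
  | 0%N => fun y z => y = 0 /\ z = 0
  | 1%N => Q
  | m'.+1 => fun y z => exists2 i, i < y + 1 & exists2 x, x < z + 1 &
      exists2 y', y' < y + 1 & exists2 z', z' < z + 1 &
      y = pairing i y' /\ (z = pairing x z' /\ (Q i x /\ rel_code m' y' z'))
  end.

Lemma rel_codeP s z :
  rel_code (size s) (code s) z <-> exists t, Forall2 Q s t /\ z = code t.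
Proof.
elim: s z => [|i [|j s] IH] z.
- split=> [[_ ->]|[t [h ->]]]; first by exists [::].
  by inversion h.
- split=> [h|[t [h ->]]]; first by exists [:: z]; split=> //; constructor.
  inversion h as [|? x ? u Qx h']; subst.
  by inversion h'.
split=> [|[t [h ->]]].
  move=> [i' _ [x _ [y' _ [z' _ [/pairing_inj[-> <-] [-> [Qx /IH[t [h ->]]]]]]]]].
  inversion h as [|? y ? u Qy h']; subst.
  by exists [:: x, y & u]; split=> //; constructor.
inversion h as [|? x ? u Qx h']; subst.
have /IH hc : exists t, Forall2 Q (j :: s) t /\ code u = code t by exists u.
inversion h' as [|? y ? u' Qy h'']; subst.
exists i; first by apply/ltS; apply: pairing_gel.
exists x; first by apply/ltS; apply: pairing_gel.
exists (code (j :: s)); first by apply/ltS; apply: pairing_ger.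
by exists (code (y :: u')) => //; apply/ltS; apply: pairing_ger.
Qed.

End RelationCodes.

Lemma rel_code_flip (Q : M -> M -> Prop) m y z :
  rel_code Q m y z <-> rel_code (fun x i => Q i x) m z y.
Proof.
elim: m y z => [|[|m] IH] y z //; first by split=> -[].
split=> -[i iy [x xz [y' yy' [z' zz' [yE [zE [Qx /IH h]]]]]]].
  by exists x => //; exists i => //; exists z' => //; exists y'.
by exists x => //; exists i => //; exists z' => //; exists y'.
Qed.

Lemma rel_codePr (Q : M -> M -> Prop) t y :
  rel_code Q (size t) y (code t) <-> exists s, Forall2 Q s t /\ y = code s.
Proof.
rewrite rel_code_flip rel_codeP.
by split=> -[s [h ->]]; exists s; split=> //; apply: Forall2_flip.
Qed.

(** The arity [m] is a standard number, so the recursion unfolds to a fixed formula; the parameter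
    [k] serves the varying bound in [pullback_coded]. *)
Lemma rel_code_rec (Q : M -> M -> M -> Prop) m :
  rec3 Q -> rec3 (fun k => rel_code (Q k) m).
Proof.
move=> DQ; elim: m => [|[|m] IH] //; first by rewrite /rel_code; d0.
suff step (C : M -> M -> M -> Prop) : rec3 C -> rec3 (fun k y z : M =>
    exists2 i, i < y + 1 & exists2 x, x < z + 1 &
    exists2 y', y' < y + 1 & exists2 z', z' < z + 1 &
    y = pairing i y' /\ (z = pairing x z' /\ (Q k i x /\ C k y' z'))).
  exact: step IH.
by move=> DC; rewrite /pairing; d0.
Qed.

Lemma code_le s t : Forall2 (@le M) s t -> code s <= code t.
Proof.
elim=> [|i x [|j s'] [|y t'] ix h IH] //; try by inversion h.
  exact: le_refl.
exact: le_pairing.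
Qed.

Lemma dterm_code m (t : (nat -> M) -> M) :
  dterm t -> dterm (fun e => code (nseq m (t e))).
Proof.
move=> Dt; elim: m => [|[|m] IH] //; first exact: dterm_cst.
exact: dterm_pairing.
Qed.

Lemma Forall2_nseq (Q : M -> M -> Prop) s a :
  (forall x, In x s -> Q x a) -> Forall2 Q s (nseq (size s) a).
Proof.
elim: s => [|x s IH] h; constructor; first by apply: h; left.
by apply: IH => y ys; apply: h; right.
Qed.

Lemma cut_bound I s : cut I -> (forall i : M, In i s -> I i) ->
  exists2 k, I k & forall i : M, In i s -> i <= k.
Proof.
move=> [I0 _ _]; elim: s => [|x s IH] h; first by exists 0.
have [|k Ik hk] := IH; first by move=> i si; apply: h; right.
case: (le_total x k) => xk; first by exists k => // i [<- //|/hk].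
exists x; first by apply: h; left.
move=> i [<-|/hk ik]; [exact: le_refl | exact: le_trans xk].
Qed.

(** If the components of [s] are at most [k] in [I], their images are at most the stage [w] of [k];
    this bounds the search for [t] and lets [coding] decide the preimage for each such [k]. Bounded
    comprehension then collects the codes of tuples, each judged at the least bound of its
    components. *)
Lemma pullback_coded I W (G : M -> M -> Prop) S m : cut I -> proper I ->
  modulus I W -> rec2 G ->
  (forall i x, G i x -> W i x) -> rec1 S -> exists a, forall s, size s = m ->
  (forall i, In i s -> I i) ->
  ((exists t, Forall2 G s t /\ S (code t)) <-> Ack a (code s)).
Proof.
move=> cutI propI modW DG GW DS.
have [b Ib] : exists b, ~ I b by apply: not_all_ex_not.
have [_ Idown _] := cutI.
(* [code (nseq m w)] is the largest code of an [m]-tuple with components at most [w]. *)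
pose Phi (_ y w : M) :=
  exists2 z, z < code (nseq m w) + 1 & rel_code G m y z /\ S z.
have DPhi : rec3 Phi.
  have Dm : rec2 (rel_code G m).
    have := rel_code_rec (Q := fun _ => G) m; rewrite /rec3 /rec2 => h.
    apply: (rec3_app (P := fun _ => rel_code G m) (t := fun=> 0)); try by d0.
    by apply: h; d0.
  by rewrite /Phi; d0; apply: dterm_code; d0.
pose N := code (nseq m b) + 1.
have [T DT TE] := coding N cutI modW Ib DPhi.
(* Lifting the diagonal up to [k] expresses that [y] codes an [m]-tuple with components at most
   [k]. *)
pose bd k y := rel_code (fun i x : M => i = x /\ i <= k) m y y.
have Dbd : rec2 bd.
  apply: (rec3_app (P := fun k => rel_code (fun i x : M => i = x /\ i <= k) m));
    try by d0.
  by apply: rel_code_rec; d0.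
have bdE k s : size s = m -> bd k (code s) <-> forall i, In i s -> i <= k.
  move=> sm; rewrite /bd -sm rel_codeP; split=> [[t [h _]]|h].
    by elim: h => [|i x s' t' [_ ik] _ IH] j //= [<-|/IH].
  exists s; split=> //; elim: s {sm} h => [|i s IH] h; constructor.
    by split=> //; apply: h; left.
  by apply: IH => j js; apply: h; right.
have [|a _ aE] := @bounded_comprehension (fun y => exists2 k, k < b + 1 &
  (bd k y /\ forall k', k' < k -> ~ bd k' y) /\ T k y) N; first by d0.
exists a => s sm sI; rewrite aE.
have sN : code s < N.
  apply/ltS/code_le; rewrite -sm; apply: Forall2_nseq => i /sI Ii.
  by apply/ltW/ltNge => -[/(Idown _ _ Ii)|bi] //; apply: Ib; rewrite bi.
(* T k y is meaningful for k in I only; the least bound of s is in I. *)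
have [k0 Ik0 /(bdE _ _ sm) bk0] := cut_bound cutI sI.
have [|k bk [kk0 kmin]] := @least (bd^~ (code s)) k0 _ bk0; first by d0.
have Ik : I k by case: kk0 => [/Idown|->]; [apply|].
have /(modulus_dom modW)[w Wk] := Ik.
have kb : k < b + 1.
  by apply/ltS/ltW/ltNge => -[/(Idown _ _ Ik)|bi] //; apply: Ib; rewrite bi.
have PhiE : Phi k (code s) w <-> exists t, Forall2 G s t /\ S (code t).
  rewrite /Phi -sm; split=> [[z _ [/rel_codeP[t [Gt ->]] St]]|[t [Gt St]]].
    by exists t.
  exists (code t); last by split=> //; apply/rel_codeP; exists t.
  apply/ltS/code_le; move: ((bdE _ _ sm).1 bk).
  elim: Gt => [|i x s' t' Gix _ IH] h; constructor; last first.
    by apply: IH => j js; apply: h; right.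
  by apply: (modulus_mono modW) (GW _ _ Gix) Wk; apply: h; left.
rewrite -PhiE -(TE _ _ Wk _ sN); split=> [Tk|[_ [k' _ [[bk' kmin'] Tk']]]].
  by split=> //; exists k.
suff -> : k = k' by [].
apply: le_anti; apply/leNgt => h; [exact: kmin h bk' | exact: kmin' h bk].
Qed.

(** Since [G] never decreases an element, the preimage of a tuple has a code at most [code t], so
    the image is Delta^0_0 without any appeal to [coding]. *)
Lemma pushforward_set (G : M -> M -> Prop) a m : rec2 G ->
  (forall i x, G i x -> i <= x) ->
  exists2 X, sets X & forall t, size t = m ->
  ((exists s, Forall2 G s t /\ Ack a (code s)) <-> X (code t)).
Proof.
move=> DG Gle.
exists (fun z => exists2 y, y < z + 1 & rel_code G m y z /\ Ack a y).
  apply: sets_rec1.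
  have Dm : rec2 (rel_code G m).
    have h := rel_code_rec (Q := fun _ => G) m.
    apply: (rec3_app (P := fun _ => rel_code G m) (t := fun=> 0)); try by d0.
    by apply: h; d0.
  by d0.
move=> t <-; split=> [[s [Gs As]]|[y _ [/rel_codePr[s [Gs ->]] As]]];
  last by exists s.
exists (code s); last by split=> //; apply/rel_codePr; exists s.
by apply/ltS/code_le; elim: Gs => [|i x s' t' /Gle ix _ IH]; constructor.
Qed.

End Model.

(** * Second-order satisfaction *)

Lemma tnth_Forall2 (A B C : Type) (Q : C -> B -> Prop) (f : A -> C) m
    (s : m.-tuple A) (t : m.-tuple B) :
  (forall l, Q (f (tnth s l)) (tnth t l)) <-> Forall2 Q (map f s) t.
Proof.
elim: m s t => [|m IH] s t.
  by rewrite (tuple0 s) (tuple0 t); split=> // _; case.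
case/tupleP: s => x s; case/tupleP: t => y t /=; split=> h.
  constructor; first by have := h ord0; rewrite !tnth0.
  by apply/IH => l; have := h (lift ord0 l); rewrite !tnthS.
inversion h as [|? ? ? ? Qxy hst]; subst; move/IH: hst => hst l.
by case: (unliftP ord0 l) => [j|] ->; [rewrite !tnthS | rewrite !tnth0].
Qed.

(** Inversion for the indexed family: the motive is generalized over the context, and is trivial on
    the empty one, so that the dependent match is well typed. *)
Lemma rvar_cons_ind m G (P : forall m', rvar (m :: G) m' -> Prop) :
  P m (RZ G m) -> (forall m' (v : rvar G m'), P m' (RS m v)) ->
  forall m' v, P m' v.
Proof.
move=> P0 PS m' v.
refine (match v as v0 in rvar G0 m0 return
    match G0 return rvar G0 m0 -> Prop with
    | [::] => fun=> True
    | m1 :: G1 => fun v0 => forall P : forall m', rvar (m1 :: G1) m' -> Prop,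
        P m1 (RZ G1 m1) -> (forall m' (w : rvar G1 m'), P m' (RS m1 w)) -> P m0 v0
    end v0 with RZ _ _ => _ | RS _ _ _ _ => _ end P P0 PS).
  by move=> P' h _.
by move=> P' _ h.
Qed.

Fixpoint map_renv T U (F : forall m, relation T m -> relation U m) G :
    renv T G -> renv U G :=
  if G is m :: G' then fun r => (F m r.1, map_renv F (G := G') r.2) else fun=> tt.

Lemma lookup_map_renv T U (F : forall m, relation T m -> relation U m) G
    (r : renv T G) m (v : rvar G m) : lookup v (map_renv F r) = F m (lookup v r).
Proof. by elim: v r => {G m} [G m|G m m' v IH] r //=; rewrite IH. Qed.

Section Transfer.

Context (N N' : rel_structure) (G : N' -> N -> Prop).
Context (Gle : forall i j x y, G i x -> G j y -> (rle i j <-> rle x y)).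
Context (Gfun : forall i x y, G i x -> G i y -> x = y).
Context (Ginj : forall i j x, G i x -> G j x -> i = j).

Definition rel_tuple m (s : m.-tuple N') (t : m.-tuple N) : Prop :=
  forall l, G (tnth s l) (tnth t l).

Definition rel_image m (R : relation N' m) : relation N m :=
  fun t => exists2 s, rel_tuple s t & R s.

Definition rel_preimage m (R : relation N m) : relation N' m :=
  fun s => exists2 t, rel_tuple s t & R t.

Context (images : forall m (R : relation N' m), rels R -> rels (rel_image R)).
Context (preimages : forall m (R : relation N m), rels R ->
  rels (rel_preimage R)).

Lemma rel_image_tuple m (R : relation N' m) s t :
  rel_tuple s t -> rel_image R t <-> R s.
Proof.
move=> st; split=> [[s' s't]|]; last by exists s.
suff -> : s' = s by [].
by apply: eq_from_tnth => l; apply: Ginj (s't l) (st l).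
Qed.

Lemma rel_preimage_tuple m (R : relation N m) s t :
  rel_tuple s t -> rel_preimage R s <-> R t.
Proof.
move=> st; split=> [[t' st']|]; last by exists t.
suff -> : t' = t by [].
by apply: eq_from_tnth => l; apply: Gfun (st' l) (st l).
Qed.

Lemma in_rels_image (P : N' -> Prop) :
  in_rels P -> in_rels (fun x => exists2 i, G i x & P i).
Proof.
move=> /images; rewrite /in_rels; congr rels.
apply: functional_extensionality => t; apply: propositional_extensionality.
split=> [[s st Ps]|[i it Pi]]; first by exists (thead s) => //; apply: st.
exists [tuple i]; last by rewrite theadE.
by move=> l; rewrite (ord1 l).
Qed.

Lemma in_rels_preimage (P : N -> Prop) :
  in_rels P -> in_rels (fun i => exists2 x, G i x & P x).
Proof.
move=> /preimages; rewrite /in_rels; congr rels.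
apply: functional_extensionality => s; apply: propositional_extensionality.
split=> [[t st Pt]|[x sx Px]]; first by exists (thead t) => //; apply: st.
exists [tuple x]; last by rewrite theadE.
by move=> l; rewrite (ord1 l).
Qed.

Context (H : N -> Prop) (H' : N' -> Prop).
Context (HG : forall x, H x -> exists i, G i x).
Context (HG' : forall i, H' i -> exists x, G i x).
Context (HH' : forall i x, G i x -> (H' i <-> H x)).

(** Members of [H] and [H'] have partners under [G], which handles first-order quantifiers;
    second-order ones pass to [rel_image] and [rel_preimage]. The environments need only agree on
    related tuples, since no others are evaluated. *)
Lemma so_sat_transfer Gam n (f : so_formula Gam n) (r : renv N Gam)
    (r' : renv N' Gam) (e : 'I_n -> N) (e' : 'I_n -> N') :
  (forall m (v : rvar Gam m) s t, rel_tuple s t ->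
     (lookup v r t <-> lookup v r' s)) ->
  (forall k, G (e' k) (e k)) ->
  so_sat H f r e <-> so_sat H' f r' e'.
Proof.
have scons_rel n' i x (d : 'I_n' -> N) (d' : 'I_n' -> N') : G i x ->
    (forall k, G (d' k) (d k)) -> forall k, G (scons i d' k) (scons x d k).
  by move=> ix h k; rewrite /scons; case: (unlift ord0 k).
elim: f r r' e e' => {Gam n} [Gam n x y|Gam n x y|Gam n m v xs|Gam n g IH
  |Gam n g IHg h IHh|Gam n g IHg h IHh|Gam n g IH|Gam n g IH|Gam n m g IH
  |Gam n m g IH]
  r r' e e' hr he /=.
- split=> [exy|e'xy].
    by apply: (Ginj (he x)); rewrite exy; apply: he.
  by apply: (Gfun (he x)); rewrite e'xy; apply: he.
- by rewrite (Gle (he x) (he y)).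
- by apply: hr => l; rewrite !tnth_map.
- by have := IH r r' e e' hr he; tauto.
- by have := IHg r r' e e' hr he; have := IHh r r' e e' hr he; tauto.
- by have := IHg r r' e e' hr he; have := IHh r r' e e' hr he; tauto.
- split=> h a ha.
    have [x ax] := HG' ha;
      apply/(IH r r' (scons x e) (scons a e') hr (scons_rel _ _ _ _ _ ax he)).
    exact/h/(HH' ax).
  have [i ia] := HG ha;
    apply/(IH r r' (scons a e) (scons i e') hr (scons_rel _ _ _ _ _ ia he)).
  exact/h/(HH' ia).
- split=> -[a ha h].
    have [i ia] := HG ha; exists i; first exact/(HH' ia).
    exact/(IH r r' (scons a e) (scons i e') hr (scons_rel _ _ _ _ _ ia he)).
  have [x ax] := HG' ha; exists x; first exact/(HH' ax).
  exact/(IH r r' (scons x e) (scons a e') hr (scons_rel _ _ _ _ _ ax he)).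
- have ext (R : relation N m) (R' : relation N' m) :
      (forall s t, rel_tuple s t -> (R t <-> R' s)) ->
      forall m' (v : rvar (m :: Gam) m') s t, rel_tuple s t ->
      (lookup v (R, r) t <-> lookup v (R', r') s).
    by move=> RR'; apply: rvar_cons_ind => [|m' v]; [exact: RR' | exact: hr].
  split=> h R relR onR.
    apply/(IH (rel_image R, r) (R, r') e e' _ he).
      by apply: ext => s t; apply: rel_image_tuple.
    apply: h; first exact: images.
    by move=> t [s st /onR Hs] l; apply/(HH' (st l)).
  apply/(IH (R, r) (rel_preimage R, r') e e' _ he).
    by apply: ext => s t /(@rel_preimage_tuple _ R) ->.
  apply: h; first exact: preimages.
  by move=> s [t st /onR Ht] l; apply/(HH' (st l)).
have ext (R : relation N m) (R' : relation N' m) :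
    (forall s t, rel_tuple s t -> (R t <-> R' s)) ->
    forall m' (v : rvar (m :: Gam) m') s t, rel_tuple s t ->
    (lookup v (R, r) t <-> lookup v (R', r') s).
  by move=> RR'; apply: rvar_cons_ind => [|m' v]; [exact: RR' | exact: hr].
split=> -[R [relR onR h]].
  exists (rel_preimage R); split; first exact: preimages.
    by move=> s [t st /onR Ht] l; apply/(HH' (st l)).
  apply/(IH (R, r) (rel_preimage R, r') e e' _ he) => //.
  by apply: ext => s t /(@rel_preimage_tuple _ R) ->.
exists (rel_image R); split; first exact: images.
  by move=> t [s st /onR Hs] l; apply/(HH' (st l)).
apply/(IH (rel_image R, r) (R, r') e e' _ he) => //.
by apply: ext => s t; apply: rel_image_tuple.
Qed.

End Transfer.

Lemma size_Forall2 (A B : Type) (Q : A -> B -> Prop) s t :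
  Forall2 Q s t -> size s = size t.
Proof. by elim=> [|x y s' t' _ _ IH] //=; rewrite IH. Qed.

(** * The isomorphism as a relation between the two structures *)

Section CutTransfer.

Context (M : L2_structure) (I : M -> Prop).
Context (HM : RCA0_star M) (cutI : cut I) (sigmaI : sigma01 I) (propI : proper I).
Context (D : M -> Prop) (E : M -> Prop).
Context (DD : rec1 D) (unbD : forall i, I i -> exists j, [/\ I j, D j & i <= j]).
Context (DE : rec1 E) (unbE : forall x, exists2 y, E y & x <= y).

(** [D] and [E] are kept free because the two directions of the theorem instantiate them
    differently: a coded set with all of [M], or the whole cut with a set. *)
Lemma cut_transfer : exists G : cut_structure I -> full_structure M -> Prop,
  [/\ [/\ forall i j x y, G i x -> G j y -> (rle i j <-> rle x y),
          forall i x y, G i x -> G i y -> x = y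
        & forall i j x, G i x -> G j x -> i = j],
      forall i x, G i x -> D (sval i) /\ E x,
      forall i x, exists j y, [/\ G j y, rle i j & rle x y],
      forall m (R : relation (cut_structure I) m), rels R -> rels (rel_image G R)
    & forall m (R : relation (full_structure M) m), rels R ->
      rels (rel_preimage G R)].
Proof.
have [W [G [modW DG GW Glt Gcof]]] := cofinal_isomorphism HM cutI sigmaI propI
  DD unbD DE unbE.
have GI i x : G i x -> I i.
  by case/GW => Wi _ _; apply/(modulus_dom modW); exists x.
have Gle i j x y : G i x -> G j y -> (i <= j <-> x <= y).
  move=> Gi Gj; split=> -[h|h].
  - exact/ltW/(Glt _ _ _ _ Gi Gj).
  - right; case/GW: Gi => Wi _ _; case/GW: Gj => Wj _ _.
    by apply: (modulus_fun modW) Wi _; rewrite h.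
  - apply/(leNgt HM) => /(Glt _ _ _ _ Gj Gi); apply/(leNgt HM).
    exact: ltW.
  - apply/(leNgt HM) => /(Glt _ _ _ _ Gj Gi); rewrite h; exact: lt_irr.
have Gfun i x y : G i x -> G i y -> x = y.
  by case/GW => Wx _ _ /GW[Wy _ _]; apply: (modulus_fun modW) Wx Wy.
have Ginj i j x : G i x -> G j x -> i = j.
  move=> Gi Gj; apply: (le_anti HM);
    [apply/(Gle _ _ _ _ Gi Gj) | apply/(Gle _ _ _ _ Gj Gi)]; exact: le_refl.
exists (fun i x => G (sval i) x); split.
- split=> [i j x y|i x y|[i Ii] [j Ij] x /=]; [exact: Gle | exact: Gfun |].
  move=> Gi Gj; move: Ii Ij; rewrite (Ginj _ _ _ Gi Gj) => Ii Ij.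
  by rewrite (proof_irrelevance _ Ii Ij).
- by move=> i x /GW[].
- move=> [i Ii] x; have [j [y [Gj ij xy]]] := Gcof i x Ii.
  by exists (exist _ j (GI _ _ Gj)), y.
- move=> m R [a Ra].
  have [|X sX XE] := pushforward_set HM a m DG.
    by move=> i x /GW[Wi _ _]; apply: modulus_ge modW _ _ Wi.
  exists X => // t; rewrite -XE ?size_tuple //; split=> [[s st Rs]|[s [st As]]].
    by exists (map sval s); split; [apply/tnth_Forall2 | apply/Ra].
  have sm : size s == m by rewrite (size_Forall2 st) size_tuple.
  have h : forall l, G (tnth (Tuple sm) l) (tnth t l).
    by apply/(tnth_Forall2 G id); rewrite map_id.
  pose s' : m.-tuple (cut_structure I) := [tuple exist I _ (GI _ _ (h l))
                                            | l < m].
  have s'E : map sval s' = s.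
    transitivity (val [tuple of map sval s']) => //;
      transitivity (val (Tuple sm)) => //.
    by congr val; apply: eq_from_tnth => l; rewrite tnth_map tnth_mktuple.
  exists s'; first by move=> l; rewrite tnth_mktuple; apply: h.
  by apply/Ra; rewrite s'E.
move=> m R [X sX RX].
have [|a aE] := @pullback_coded M HM I W G X m cutI propI modW DG _
  (rec1_sets sX).
  by move=> i x /GW[].
exists a => s; rewrite -aE ?size_map ?size_tuple //; last first.
  by move=> i /in_map_iff[[j Ij] [<- _]].
split=> [[t st Rt]|[t [st Xt]]].
  by exists t; split; [apply/tnth_Forall2 | apply/RX].
have tm : size t == m by rewrite -(size_Forall2 st) size_map size_tuple.
by exists (Tuple tm); [exact/(tnth_Forall2 G sval) | apply/RX].
Qed.

End CutTransfer.

Theorem theorem3p5 (chi : pSO_sentence) (M : L2_structure) (I : M -> Prop)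
    (HM : RCA0_star M) (cutI : cut I) (sigmaI : sigma01 I) (properI : proper I) :
  pSO_sat (full_structure M) chi <-> pSO_sat (cut_structure I) chi.
Proof.
have I0 : I zero by case: cutI.
split=> hchi r relr D.
  (* From [M] to [I]: the instance on the cut is sent to [M] by [G] and solved there, and the
     solution is pulled back. *)
  move=> relD unbD; have [a Da] := iffLR (in_rels_cut D) relD.
  have [||||G [[Gle Gfun Ginj] GDE Gcof images preimages]] :=
      @cut_transfer M I HM cutI sigmaI properI (Ack a) (fun=> True).
  - by have DA := rec2_Ack HM; d0.
  - by move=> i Ii; have [[j Ij] /Da Aj ij] := unbD (exist _ i Ii); exists j.
  - exact: D0_true.
  - by move=> x; exists x => //; apply: le_refl.
  have [|||H [relH HD unbH satH]] :=
      hchi (map_renv (@rel_image _ _ G) r) _ (fun x => exists2 i, G i x & D i).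
  - by move=> m v; rewrite lookup_map_renv; apply: images.
  - exact: in_rels_image.
  - move=> x; have [j [y [Gy _ xy]]] := Gcof (exist _ zero I0) x.
    by exists y => //; exists j => //; apply/Da; case: (GDE _ _ Gy).
  exists (fun i => exists2 x, G i x & H x); split.
  - exact: in_rels_preimage.
  - by move=> i [x /GDE[/Da]].
  - move=> i; have [j [y [Gy ij _]]] := Gcof i zero.
    have [z Hz yz] := unbH y; have [k Gz _] := HD z Hz.
    exists k; first by exists z.
    apply: (le_trans HM (y := sval j)) => //; exact/(Gle _ _ _ _ Gy Gz).
  apply: (iffLR (so_sat_transfer Gle Gfun Ginj images preimages (H := H)
    _ _ _ _ _ _) satH).
  - by move=> x /HD[i Gi _]; exists i.
  - by move=> i [x Gx _]; exists x.
  - by move=> i x Gx; split=> [[y /(Gfun _ _ _ Gx) <-]|Hx] //; exists x.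
  - by move=> m v s t st; rewrite lookup_map_renv; apply: rel_image_tuple.
  by case.
(* From [I] to [M]: the instance is pulled back to the cut, and the solution found there is sent
   forward. *)
move=> relD unbD; have [X sX DX] := iffLR (in_rels_full D) relD.
have [||||G [[Gle Gfun Ginj] GDE Gcof images preimages]] :=
    @cut_transfer M I HM cutI sigmaI properI (fun=> True) X.
- exact: D0_true.
- by move=> i Ii; exists i; split=> //; apply: le_refl.
- exact: rec1_sets.
- by move=> x; have [y /DX Xy xy] := unbD x; exists y.
have [|||H [relH HD unbH satH]] :=
    hchi (map_renv (@rel_preimage _ _ G) r) _ (fun i => exists2 x, G i x & D x).
- by move=> m v; rewrite lookup_map_renv; apply: preimages.
- exact: in_rels_preimage.
- move=> i; have [j [y [Gy ij _]]] := Gcof i zero.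
  by exists j => //; exists y => //; apply/DX; case: (GDE _ _ Gy).
exists (fun x => exists2 i, G i x & H i); split.
- exact: in_rels_image.
- by move=> x [i /GDE[_ /DX]].
- move=> x; have [j [y [Gy _ xy]]] := Gcof (exist _ zero I0) x.
  have [k Hk jk] := unbH j; have [z Gz _] := HD k Hk.
  exists z; first by exists k.
  apply: (le_trans HM (y := y)) => //; exact/(Gle _ _ _ _ Gy Gz).
apply: (iffRL (so_sat_transfer Gle Gfun Ginj images preimages (H' := H)
  _ _ _ _ _ _) satH).
- by move=> x [i Gi _]; exists i.
- by move=> i /HD[x Gx _]; exists x.
- by move=> i x Gx; split=> [Hi|[j Gj Hj]];
  [exists i | rewrite (Ginj _ _ _ Gx Gj)].
- by move=> m v s t st; rewrite lookup_map_renv; apply: iff_sym;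
  apply: rel_preimage_tuple.
by case.
Qed.
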